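(* Let $k\ge1$ be an integer, let $M_k=[(z-w)^k]\subset H^2(\mathbb D^2)$, and let $C_{M_k}$ be its core operator. Then the set of eigenvalues of $C_{M_k}$ is \[ \{0,1\}\cup\left\{\pm\frac{k}{n+k}:n\ge1\right\}. \] The eigenvalue $0$ has infinite multiplicity, while the eigenvalue $1$ is simple. Moreover, the spectrum of $C_{M_k}$ is \[ \sigma(C_{M_k})=\{0,1\}\cup\left\{\pm\frac{k}{n+k}:n\ge1\right\}. \]
   Context: $H^2(\mathbb D^2)$ is the Hardy space over the bidisk, in which the monomials $z^aw^b$ ($a,b\ge0$) form an orthonormal basis. For a polynomial $p$, $[p]$ denotes the closure in $H^2(\mathbb D^2)$ of $p\,\mathbb C[z,w]$. For a submodule $M$ (a closed subspace with $zM\subseteq M$, $wM\subseteq M$), let $R_z,R_w$ be the restrictions to $M$ of multiplication by $z$ and by $w$. The core operator $C_M$ is the bounded self-adjoint operator on $H^2(\mathbb D^2)$ that vanishes on $M^\perp=H^2(\mathbb D^2)\ominus M$ and is given on $M$ by \[ C_M=I-R_zR_z^*-R_wR_w^*+R_zR_wR_z^*R_w^*. \] *)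

(* Defs.v *)
(* MathComp-Analysis over an arbitrary [R : realType], with complex scalars
   [R[i]] from mathcomp-real-closed. *)
From HB Require Import structures.
From mathcomp Require Import all_boot all_order all_algebra.
From mathcomp Require Import all_classical all_reals all_analysis.
From mathcomp.real_closed Require Import complex.
From mathcomp Require Import ring.
Import Order.TTheory GRing.Theory Num.Theory.
Import numFieldNormedType.Exports.

Set Implicit Arguments.
Unset Strict Implicit.
Unset Printing Implicit Defensive.

Local Open Scope classical_set_scope.
Local Open Scope ring_scope.
Local Open Scope complex_scope.

Lemma ge0_esumZ (R : realType) (T : choiceType) (S : set T) (c : R)
    (f : T -> \bar R) : 0 <= c -> (forall i, (0 <= f i)%E) ->
  (\esum_(i in S) (c%:E * f i) = c%:E * \esum_(i in S) f i)%E.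
Proof.
have leZ (d : R) (g : T -> \bar R) : 0 <= d -> (forall i, (0 <= g i)%E) ->
    (\esum_(i in S) (d%:E * g i) <= d%:E * \esum_(i in S) g i)%E.
  move=> d0 g0; apply: ge_ereal_sup => _ [X [finX XS] <-].
  rewrite -ge0_mule_fsumr//; apply: lee_wpmul2l; first by rewrite lee_fin.
  by apply: esum_ge; exists X.
move=> c0 f0; apply/eqP; rewrite eq_le leZ//=.
have [->|c_neq0] := eqVneq c 0.
  by rewrite mul0e; apply: esum_ge0 => i _; rewrite mul0e.
have c_gt0 : 0 < c by rewrite lt_neqAle eq_sym c_neq0.
rewrite -lee_pdivlMl// (eq_esum (b := fun i => (c^-1%:E * (c%:E * f i))%E)).
  by apply: leZ => [|i]; rewrite ?invr_ge0// mule_ge0.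
by move=> i _; rewrite muleA -EFinM mulVf// mul1e.
Qed.

(** * The Hardy space over the bidisk *)

(* A function on the bidisk is represented by its power series coefficients:
   [f (a, b)] is the coefficient of z^a w^b, and f is in H^2(D^2) iff its
   coefficients are square summable. *)

Section SquareSummable.
Variable R : realType.
Implicit Types (f g : nat * nat -> R[i]) (c : R[i]).

Definition sqnorm f : \bar R :=
  \esum_(i in [set: nat * nat]) (Normc.normc (f i) ^+ 2)%:E.

Definition square_summable : {pred nat * nat -> R[i]} :=
  fun f => (sqnorm f < +oo)%E.

Lemma sqnorm_ge0 f : (0 <= sqnorm f)%E.
Proof. by apply: esum_ge0 => i _; rewrite lee_fin sqr_ge0. Qed.

Lemma normc_ge0 c : 0 <= Normc.normc c.
Proof. by case: c => a b; exact: sqrtr_ge0. Qed.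

Lemma sqnormZ c f : (sqnorm (c *: f)%R = (Normc.normc c ^+ 2)%:E * sqnorm f)%E.
Proof.
rewrite /sqnorm -ge0_esumZ ?sqr_ge0//; last by move=> i; rewrite lee_fin sqr_ge0.
by apply: eq_esum => i _; rewrite -EFinM -exprMn -Normc.normcM.
Qed.

Lemma sqnormD_le (t : R) f g : 0 < t ->
  (sqnorm (f + g)%R <= (1 + t)%:E * sqnorm f + (1 + t^-1)%:E * sqnorm g)%E.
Proof.
move=> t0; have t1 : 0 < t^-1 by rewrite invr_gt0.
rewrite /sqnorm -!ge0_esumZ; do ?[by rewrite ltW// addr_gt0];
  do ?[by move=> i; rewrite lee_fin sqr_ge0].
rewrite -esumD; do ?[by move=> i _; rewrite -EFinM lee_fin mulr_ge0 ?sqr_ge0//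
  ltW// addr_gt0].
apply: le_esum => i _; rewrite -!EFinM -EFinD lee_fin.
have /le_trans := lerXn2r 2 (normc_ge0 _) (addr_ge0 (normc_ge0 _) (normc_ge0 _))
  (le_normcD (f i) (g i)); apply.
set x := Normc.normc _; set y := Normc.normc _.
rewrite -subr_ge0.
have -> : (1 + t) * x ^+ 2 + (1 + t^-1) * y ^+ 2 - (x + y) ^+ 2 =
  t * (x - t^-1 * y) ^+ 2 by field; rewrite gt_eqF.
by rewrite mulr_ge0 ?sqr_ge0// ltW.
Qed.

Lemma sqnorm0 : sqnorm 0 = 0%E.
Proof. by apply: esum1 => i _; rewrite Normc.normc0 expr0n. Qed.

Lemma square_summable_submod_closed : submod_closed square_summable.
Proof.
split=> [|c f g]; rewrite !unfold_in; first by rewrite sqnorm0 ltry.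
move=> foo goo; apply: le_lt_trans (sqnormD_le _ _ ltr01) _.
by rewrite sqnormZ lte_add_pinfty// !lte_mul_pinfty//
  ?mule_ge0 ?lee_fin ?sqr_ge0 ?sqnorm_ge0// addr_ge0 ?invr_ge0.
Qed.

HB.instance Definition _ := GRing.isSubmodClosed.Build _ _ square_summable
  square_summable_submod_closed.

End SquareSummable.

Record hardy (R : realType) := Hardy {
  coef :> nat * nat -> R[i];
  coef_square_summable : coef \in @square_summable R }.

Section HardyNormed.
Variable R : realType.

HB.instance Definition _ := [isSub for @coef R].
HB.instance Definition _ := [Choice of hardy R by <:].
HB.instance Definition _ := [SubChoice_isSubLmodule of hardy R by <:].

Definition hardy_norm (f : hardy R) : R[i] := (Num.sqrt (fine (sqnorm f)))%:C.

Implicit Types f g : hardy R.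

Lemma sqnorm_fin f : sqnorm f \is a fin_num.
Proof. by rewrite ge0_fin_numE ?sqnorm_ge0//; exact: (coef_square_summable f). Qed.

Lemma hardy_norm_eq0 f : hardy_norm f = 0 -> f = 0.
Proof.
move=> [/eqP]; rewrite sqrtr_eq0 => f0; apply/val_inj/funext => i /=.
apply: Normc.eq0_normc; apply/eqP; rewrite -sqrf_eq0 eq_le sqr_ge0 andbT.
rewrite (le_trans _ f0)// -lee_fin fineK ?sqnorm_fin//.
by apply: esum_ge; exists [set i]; [split|rewrite fsbig_set1].
Qed.

Lemma hardy_normZ (c : R[i]) f : hardy_norm (c *: f) = `|c| * hardy_norm f.
Proof.
rewrite /hardy_norm (sqnormZ c f) fineM ?sqnorm_fin//= sqrtrM ?sqr_ge0//.
by rewrite sqrtr_sqr ger0_norm ?normc_ge0// rmorphM; congr (_ * _); case: c.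
Qed.

Lemma hardy_normD f g : hardy_norm (f + g) <= hardy_norm f + hardy_norm g.
Proof.
have [->|f0] := eqVneq f 0; first by rewrite add0r lerDr lecR sqrtr_ge0.
have [->|g0] := eqVneq g 0; first by rewrite addr0 lerDl lecR sqrtr_ge0.
have gt0 (h : hardy R) : h != 0 -> 0 < Num.sqrt (fine (sqnorm h)).
  move=> h0; rewrite lt_def sqrtr_ge0 andbT; apply: contra_neq h0 => h0.
  by apply: hardy_norm_eq0; rewrite /hardy_norm h0.
rewrite -rmorphD lecR; move: (gt0 _ f0) (gt0 _ g0).
set a := Num.sqrt _ => a0; set b := Num.sqrt _ => b0.
rewrite -[leRHS]ger0_norm; last by rewrite addr_ge0// ltW.
rewrite -sqrtr_sqr; apply: ler_wsqrtr.
rewrite -lee_fin fineK ?sqnorm_fin//.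
have t0 : 0 < b / a by rewrite divr_gt0.
apply: le_trans (sqnormD_le f g t0) _.
have sqE (h : hardy R) : sqnorm h = (Num.sqrt (fine (sqnorm h)) ^+ 2)%:E.
  by rewrite sqr_sqrtr ?fineK ?sqnorm_fin// fine_ge0 ?sqnorm_ge0.
rewrite (sqE f) (sqE g) -/a -/b -!EFinM -EFinD lee_fin.
by rewrite le_eqVlt; apply/orP; left; apply/eqP; field; rewrite !gt_eqF.
Qed.

HB.instance Definition _ := Lmodule_isNormed.Build R[i] (hardy R)
  hardy_normD hardy_normZ hardy_norm_eq0.

End HardyNormed.

Section HardyOperators.
Variable R : realType.
Implicit Types (f g : hardy R) (M : set (hardy R)).

(* The sum of an absolutely summable family indexed by [nat * nat]: positive
   part minus negative part for reals, componentwise for complex numbers. *)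
Definition real_sum (u : nat * nat -> R) : R :=
  fine (\esum_(i in [set: nat * nat]) (Num.max (u i) 0)%:E) -
  fine (\esum_(i in [set: nat * nat]) (Num.max (- u i) 0)%:E).

Definition complex_sum (u : nat * nat -> R[i]) : R[i] :=
  real_sum (fun i => complex.Re (u i)) +i* real_sum (fun i => complex.Im (u i)).

(* Linear in the first argument. *)
Definition hardy_dot f g : R[i] := complex_sum (fun i => f i * (g i)^*).

Lemma sqnorm_push (e : nat * nat -> nat * nat) (f g : nat * nat -> R[i]) :
    injective e -> (forall i, g (e i) = f i) ->
    (forall j, ~ range e j -> g j = 0) ->
  sqnorm g = sqnorm f.
Proof.
move=> e_inj ge g0.
transitivity (\esum_(j in range e) (Normc.normc (g j) ^+ 2)%:E)%E.
  rewrite [RHS]esum_mkcond; apply: eq_esum => j _; case: ifPn => // /negP je.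
  by rewrite g0 ?Normc.normc0 ?expr0n// => /mem_set.
rewrite esum_image; last by move=> i j _ _; exact: e_inj.
by apply: eq_esum => i _; rewrite ge.
Qed.

Definition mulz_coef f (i : nat * nat) : R[i] :=
  if i.1 is a.+1 then f (a, i.2) else 0.

Definition mulw_coef f (i : nat * nat) : R[i] :=
  if i.2 is b.+1 then f (i.1, b) else 0.

Lemma mulz_square_summable f : mulz_coef f \in @square_summable R.
Proof.
rewrite unfold_in (sqnorm_push (e := fun i => (i.1.+1, i.2)) (f := f))//.
- exact: (coef_square_summable f).
- by move=> [a b] [c d] [-> ->].
- by move=> [a b].
- by move=> [[|a] b]// je; case: je; exists (a, b).
Qed.

Lemma mulw_square_summable f : mulw_coef f \in @square_summable R.
Proof.
rewrite unfold_in (sqnorm_push (e := fun i => (i.1, i.2.+1)) (f := f))//.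
- exact: (coef_square_summable f).
- by move=> [a b] [c d] [-> ->].
- by move=> [a b].
- by move=> [a [|b]]// je; case: je; exists (a, b).
Qed.

Definition mulz f : hardy R := Hardy (mulz_square_summable f).
Definition mulw f : hardy R := Hardy (mulw_square_summable f).

(* The orthogonal projection onto M, and the adjoint of the restriction of T to
   M. When M is a closed subspace and T is bounded and maps M into M, exactly
   one element has the stated property, so that the default 0 is never used
   (for the adjoint, when f is in M). *)
Definition orth_proj M f : hardy R :=
  xget 0 [set m | M m /\ forall h, M h -> hardy_dot (f - m) h = 0].

Definition adjoint_on M (T : hardy R -> hardy R) f : hardy R :=
  xget 0 [set g | M g /\ forall h, M h -> hardy_dot (T h) f = hardy_dot h g].

(* I - R_z R_z^* - R_w R_w^* + R_z R_w R_z^* R_w^* on M, and 0 on the orthogonal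
   complement of M. For a submodule M all arguments of [mulz] and [mulw] lie in M, so
   no explicit restriction of them is needed. *)
Definition core_operator M f : hardy R :=
  let Rz' := adjoint_on M mulz in
  let Rw' := adjoint_on M mulw in
  let m := orth_proj M f in
  m - mulz (Rz' m) - mulw (Rw' m) + mulz (mulw (Rz' (Rw' m))).

(* C[z, w] is [{poly {poly R[i]}}], the inner variable being z and the outer
   one w. *)
Definition poly_coef (p : {poly {poly R[i]}}) (i : nat * nat) : R[i] :=
  p`_i.2`_i.1.

Lemma poly_square_summable p : poly_coef p \in @square_summable R.
Proof.
pose n : nat := \max_(b < size p) size (p`_b)%R.
pose S : set (nat * nat) := `I_n `*` `I_(size p).
have finS : finite_set S by apply: finite_setX; exact: finite_II.
rewrite unfold_in (_ : sqnorm _ =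
  \esum_(i in S) (Normc.normc (poly_coef p i) ^+ 2)%:E); last first.
  rewrite [RHS]esum_mkcond; apply: eq_esum => -[a b] _; case: ifPn => // /negP abS.
  rewrite /poly_coef /=; suff -> : p`_b`_a = 0 by rewrite Normc.normc0 expr0n.
  have [pb|bp] := leqP (size p) b; first by rewrite (nth_default _ pb) coef0.
  have [pa|ap] := leqP (size (p`_b)%R) a; first by rewrite nth_default.
  case: abS; apply/mem_set; split => //=; apply: leq_trans ap _.
  exact: (leq_bigmax (Ordinal bp)).
rewrite esum_fset//; last by move=> i _; rewrite lee_fin sqr_ge0.
by rewrite fsumEFin// ltry.
Qed.

Definition hardy_of_poly p : hardy R := Hardy (poly_square_summable p).

Definition polyz : {poly {poly R[i]}} := 'X%:P.
Definition polyw : {poly {poly R[i]}} := 'X.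

Definition principal_submodule (p : {poly {poly R[i]}}) : set (hardy R) :=
  closure [set hardy_of_poly (p * q) | q in [set: {poly {poly R[i]}}]].

End HardyOperators.

(** * Spectral notions *)

Section Spectrum.
Variables (K : numFieldType) (V : normedModType K).
Implicit Types (T : V -> V) (A : set V) (l : K).

Definition op_eigenspace T l : set V := [set x | T x = l *: x].

Definition op_eigenvalues T : set K :=
  [set l | exists2 x, x != 0 & op_eigenspace T l x].

(* l is outside the spectrum iff T - l has a bounded inverse. *)
Definition op_spectrum T : set K :=
  [set l | ~ exists S : {linear V -> V}, [/\ continuous S,
     cancel (fun x => T x - l *: x) S & cancel S (fun x => T x - l *: x)]].

Definition linearly_independent n (v : 'I_n -> V) : Prop :=
  forall c : 'I_n -> K, \sum_(i < n) c i *: v i = 0 -> forall i, c i = 0.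

Definition has_dimension A n : Prop :=
  exists v : 'I_n -> V, linearly_independent v /\
    A = [set \sum_(i < n) c i *: v i | c in [set: 'I_n -> K]].

Definition infinite_dimensional A : Prop :=
  forall n, exists v : 'I_n -> V, linearly_independent v /\ forall i, A (v i).

End Spectrum.

(* Main.v *)
(* Everything is graded by degree. In degree N > k the core operator of M_k
   vanishes on zwM; on the two-dimensional complement of zwM in M it swaps, up to
   the factor k/N, the vectors z e and w f, where e and f span the complements of
   wM and of zM in degree N - 1. In the variable t = z/w these are the Szego
   polynomials of the weight |1 - t|^(2k) and their reversals, and k/N is their
   Verblunsky coefficient up to sign; their coefficients are products of two
   binomials, so that the orthogonality relations say that a 2k-th difference of
   a polynomial of degree 2k - 1 is zero. Hence T^3 = (k/N)^2 T in degree N, and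
   T^2 = T in degree k, where M is spanned by (z - w)^k; this yields the
   eigenvalues, and a bounded inverse of T - l for every other l because k/N
   tends to 0. *)
Require Import Defs.
From HB Require Import structures.
From mathcomp Require Import all_boot all_order all_algebra.
From mathcomp Require Import all_classical all_reals all_analysis.
From mathcomp.real_closed Require Import complex.
From mathcomp Require Import ring lra zify.
Import Order.TTheory GRing.Theory Num.Theory.
Import numFieldNormedType.Exports.

Set Implicit Arguments.
Unset Strict Implicit.
Unset Printing Implicit Defensive.

Local Open Scope classical_set_scope.
Local Open Scope complex_scope.
Local Open Scope ring_scope.

(** * Sums of complex families *)

(** No orthogonal basis of M is constructed. The core operator T is computed only on the products of
    (z - w)^k with monomials, a total but non-orthogonal family, and self-adjointness carries each
    identity over to all f: an identity between powers of T holds in degree N as soon as it holds on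
    the generators of degree N, because the powers of T can be moved to the other side of the inner
    product. Since T also preserves degrees, the resulting identities hold coefficient by
    coefficient, so that eigenvectors and resolvent reduce to scalar algebra at one monomial z^a
    w^b. The Szego picture enters because on the torus (z - w)^k z^a w^b has modulus |1 - t|^k, with
    t = z/w: in a fixed degree the Gram matrix of the generators is the Toeplitz matrix of |1 -
    t|^(2k). The relation has to be T^3 = r^2 T rather than T^2 = r^2, because of the kernel of T
    inside each degree. The projection onto M is likewise assembled from finite-dimensional
    projections, one for each degree. *)

Section RealSum.
Variable R : realType.
Implicit Types u v : nat * nat -> R.

Definition abs_summable u : Prop :=
  (\esum_(i in [set: nat * nat]) `|u i|%:E < +oo)%E.

Lemma abs_summable_le u v :
  (forall i, `|u i| <= `|v i|) -> abs_summable v -> abs_summable u.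
Proof.
by move=> uv; apply: le_lt_trans; apply: le_esum => i _; rewrite lee_fin.
Qed.

Lemma abs_summableD u v :
  abs_summable u -> abs_summable v -> abs_summable (fun i => u i + v i).
Proof.
move=> uoo voo; have : (\esum_(i in [set: nat * nat]) (`|u i|%:E + `|v i|%:E) < +oo)%E.
  by rewrite esumD// lte_add_pinfty.
by apply: le_lt_trans; apply: le_esum => i _; rewrite -EFinD lee_fin ler_normD.
Qed.

Lemma abs_summableN u : abs_summable u -> abs_summable (fun i => - u i).
Proof. by apply: abs_summable_le => i; rewrite normrN. Qed.

Lemma abs_summableZ c u : abs_summable u -> abs_summable (fun i => c * u i).
Proof.
move=> uoo; rewrite /abs_summable (eq_esum (b := fun i => (`|c|%:E * `|u i|%:E)%E)).
  by rewrite ge0_esumZ// lte_mul_pinfty// lee_fin.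
by move=> i _; rewrite normrM EFinM.
Qed.

Lemma esum_fin_num u : (forall i, 0 <= u i) -> abs_summable u ->
  (\esum_(i in [set: nat * nat]) (u i)%:E)%E \is a fin_num.
Proof.
move=> u0 us; rewrite ge0_fin_numE; last by apply: esum_ge0 => i _; rewrite lee_fin.
by apply: le_lt_trans us; apply: le_esum => i _; rewrite lee_fin ler_norm.
Qed.

(** Positive and negative parts are not additive, so linearity goes through arbitrary splittings u =
    x - y: adding up x + u^- = y + u^+ involves only nonnegative families, for which sums are
    additive. *)
Lemma real_sumE (u x y : nat * nat -> R) :
    (forall i, 0 <= x i) -> (forall i, 0 <= y i) ->
    abs_summable x -> abs_summable y -> (forall i, u i = x i - y i) ->
  real_sum u = fine (\esum_(i in [set: nat * nat]) (x i)%:E) -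
               fine (\esum_(i in [set: nat * nat]) (y i)%:E).
Proof.
move=> x0 y0 xs ys uE; have us : abs_summable u.
  by rewrite (_ : u = fun i => x i + - y i);
    [exact/abs_summableD/abs_summableN | apply/funext => i; rewrite uE].
have max0 (t : R) : 0 <= Num.max t 0 by rewrite le_max lexx orbT.
have pos_s : abs_summable (fun i => Num.max (u i) 0).
  apply: abs_summable_le us => i; rewrite ger0_norm// ge_max normr_ge0 andbT.
  exact: ler_norm.
have neg_s : abs_summable (fun i => Num.max (- u i) 0).
  apply: abs_summable_le us => i; rewrite ger0_norm// ge_max normr_ge0 andbT.
  by rewrite -normrN ler_norm.
rewrite /real_sum; apply/eqP; rewrite subr_eq addrAC eq_sym subr_eq; apply/eqP.
rewrite -!fineD ?esum_fin_num//; congr fine.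
rewrite -!esumD//; do ?by move=> i _; rewrite lee_fin.
apply: eq_esum => i _; rewrite -!EFinD; congr EFin.
rewrite uE; case: (lerP (x i - y i) 0) => h; case: (lerP (- (x i - y i)) 0) => h'; lra.
Qed.

Lemma real_sumD u v : abs_summable u -> abs_summable v ->
  real_sum (fun i => u i + v i) = real_sum u + real_sum v.
Proof.
move=> us vs.
pose P (w : nat * nat -> R) i := Num.max (w i) 0.
pose Q (w : nat * nat -> R) i := Num.max (- w i) 0.
have P0 w i : 0 <= P w i by rewrite le_max lexx orbT.
have Q0 w i : 0 <= Q w i by rewrite le_max lexx orbT.
have Ps w : abs_summable w -> abs_summable (P w).
  apply: abs_summable_le => i; rewrite ger0_norm// ge_max normr_ge0 andbT.
  exact: ler_norm.
have Qs w : abs_summable w -> abs_summable (Q w).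
  apply: abs_summable_le => i; rewrite ger0_norm// ge_max normr_ge0 andbT.
  by rewrite -normrN ler_norm.
rewrite (@real_sumE _ (fun i => P u i + P v i) (fun i => Q u i + Q v i)); last first.
- move=> i; rewrite /P /Q.
  by case: (lerP (u i) 0) => ?; case: (lerP (v i) 0) => ?;
     case: (lerP (- u i) 0) => ?; case: (lerP (- v i) 0) => ?; lra.
- by apply: abs_summableD; exact: Qs.
- by apply: abs_summableD; exact: Ps.
- by move=> i; rewrite addr_ge0.
- by move=> i; rewrite addr_ge0.
have sumD (x y : nat * nat -> R) : (forall i, 0 <= x i) -> (forall i, 0 <= y i) ->
    abs_summable x -> abs_summable y ->
    fine (\esum_(i in [set: nat * nat]) (x i + y i)%:E) =
    fine (\esum_(i in [set: nat * nat]) (x i)%:E) +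
    fine (\esum_(i in [set: nat * nat]) (y i)%:E).
  move=> x0 y0 xs ys; rewrite -fineD ?esum_fin_num// -esumD//;
  by move=> i _; rewrite lee_fin.
rewrite (sumD _ _ (P0 u) (P0 v) (Ps _ us) (Ps _ vs)).
rewrite (sumD _ _ (Q0 u) (Q0 v) (Qs _ us) (Qs _ vs)).
by rewrite /real_sum -/(P u) -/(P v) -/(Q u) -/(Q v); ring.
Qed.

Lemma real_sumN u : real_sum (fun i => - u i) = - real_sum u.
Proof.
rewrite /real_sum opprB; congr (_ - _); congr fine.
by apply: eq_esum => i _; rewrite opprK.
Qed.

Lemma real_sum_ge0 u : (forall i, 0 <= u i) ->
  real_sum u = fine (\esum_(i in [set: nat * nat]) (u i)%:E).
Proof.
move=> u0; rewrite /real_sum [X in _ - fine X]esum1 ?subr0.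
  by congr fine; apply: eq_esum => i _; rewrite max_l.
by move=> i _; rewrite max_r// oppr_le0.
Qed.

Lemma real_sumZ c u : abs_summable u ->
  real_sum (fun i => c * u i) = c * real_sum u.
Proof.
move=> us; wlog c0 : c / 0 <= c => [wl|].
  have [/wl//|c0] := lerP 0 c.
  have /wl : 0 <= - c by rewrite oppr_ge0 ltW.
  rewrite (_ : (fun i => - c * u i) = fun i => - (c * u i)).
    by rewrite real_sumN mulNr => /oppr_inj.
  by apply/funext => i; rewrite mulNr.
have max0 (t : R) : 0 <= Num.max t 0 by rewrite le_max lexx orbT.
have maxs (s : R) : `|s| = 1 -> abs_summable (fun i => Num.max (s * u i) 0).
  move=> s1; apply: abs_summable_le us => i.
  rewrite ger0_norm// ge_max normr_ge0 andbT.
  by rewrite (le_trans (ler_norm _))// normrM s1 mul1r.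
have pos_s : abs_summable (fun i => Num.max (u i) 0).
  by have := maxs 1 (normr1 _); under eq_fun do rewrite mul1r.
have neg_s : abs_summable (fun i => Num.max (- u i) 0).
  by have := maxs (-1) (normrN1 _); under eq_fun do rewrite mulN1r.
rewrite (@real_sumE _ (fun i => c * Num.max (u i) 0) (fun i => c * Num.max (- u i) 0));
  first last.
- move=> i; case: (lerP (u i) 0) => ?; case: (lerP (- u i) 0) => ?; nra.
- exact: abs_summableZ.
- exact: abs_summableZ.
- by move=> i; rewrite mulr_ge0.
- by move=> i; rewrite mulr_ge0.
have E (v : nat * nat -> R) : (forall i, 0 <= v i) -> abs_summable v ->
    fine (\esum_(i in [set: nat * nat]) (c * v i)%:E) =
    c * fine (\esum_(i in [set: nat * nat]) (v i)%:E).
  move=> v0 vs; rewrite (eq_esum (b := fun i => (c%:E * (v i)%:E)%E)).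
    by rewrite ge0_esumZ ?fineM ?esum_fin_num// => i; rewrite lee_fin.
  by move=> i _; rewrite EFinM.
rewrite (E _ (fun i => max0 (u i)) pos_s) (E _ (fun i => max0 (- u i)) neg_s).
by rewrite -mulrBr.
Qed.

End RealSum.

Section ComplexSum.
Variable R : realType.

Lemma conjCD (x y : R[i]) : (x + y)^* = x^* + y^*.
Proof. exact: rmorphD. Qed.

Lemma conjCM (x y : R[i]) : (x * y)^* = x^* * y^*.
Proof. exact: rmorphM. Qed.

Lemma conjCN (x : R[i]) : (- x)^* = - x^*.
Proof. exact: rmorphN. Qed.

Implicit Types F G : nat * nat -> R[i].

Lemma esum_push (e : nat * nat -> nat * nat) (h g : nat * nat -> \bar R) :
    injective e -> (forall i, 0 <= h i)%E -> (forall i, g (e i) = h i) ->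
    (forall j, ~ range e j -> g j = 0%E) ->
  \esum_(i in [set: nat * nat]) g i = \esum_(i in [set: nat * nat]) h i.
Proof.
move=> e_inj h0 ge g0.
transitivity (\esum_(j in range e) g j)%E.
  rewrite [RHS]esum_mkcond; apply: eq_esum => j _; case: ifPn => // /negP je.
  by rewrite g0 // => /mem_set.
rewrite esum_image; last by move=> i j _ _; exact: e_inj.
by apply: eq_esum => i _; rewrite ge.
Qed.

Lemma real_sum_push (e : nat * nat -> nat * nat) (u v : nat * nat -> R) :
    injective e -> (forall i, v (e i) = u i) ->
    (forall j, ~ range e j -> v j = 0) ->
  real_sum v = real_sum u.
Proof.
move=> e_inj ve v0; rewrite /real_sum; congr (fine _ - fine _).
  apply: (esum_push e_inj) => [i|i|j je]; rewrite ?lee_fin ?le_max ?lexx ?orbT//.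
    by rewrite ve.
  by rewrite v0// maxxx.
apply: (esum_push e_inj) => [i|i|j je]; rewrite ?lee_fin ?le_max ?lexx ?orbT//.
  by rewrite ve.
by rewrite v0// oppr0 maxxx.
Qed.

Lemma complex_sum_push (e : nat * nat -> nat * nat) F G :
    injective e -> (forall i, G (e i) = F i) ->
    (forall j, ~ range e j -> G j = 0) ->
  complex_sum G = complex_sum F.
Proof.
move=> e_inj Ge G0; rewrite /complex_sum; congr Complex;
by apply: (real_sum_push e_inj) => [i|j je]; rewrite ?Ge// G0.
Qed.

Lemma real_sum_point (u : nat * nat -> R) i0 :
  (forall i, i != i0 -> u i = 0) -> real_sum u = u i0.
Proof.
have pt (x : nat * nat -> R) : (forall i, 0 <= x i) -> (forall i, i != i0 -> x i = 0) ->
    \esum_(i in [set: nat * nat]) (x i)%:E = (x i0)%:E.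
  move=> x0 xi; transitivity (\esum_(i in [set i0]) (x i)%:E)%E; last first.
    by rewrite esum_set1 ?lee_fin.
  rewrite [RHS]esum_mkcond; apply: eq_esum => i _ /=.
  have [->|ii0] := eqVneq i i0; first by rewrite mem_set.
  by rewrite memNset ?xi// => /eqP; rewrite (negPf ii0).
have max0 (t : R) : 0 <= Num.max t 0 by rewrite le_max lexx orbT.
move=> u0; rewrite /real_sum (pt (fun i => Num.max (u i) 0)) //; last first.
  by move=> i /u0 ->; rewrite maxxx.
rewrite (pt (fun i => Num.max (- u i) 0)) //; last first.
  by move=> i /u0 ->; rewrite oppr0 maxxx.
by rewrite /=; case: (lerP (u i0) 0) => ?; case: (lerP (- u i0) 0) => ?; lra.
Qed.

Lemma complex_sum_point F i0 :
  (forall i, i != i0 -> F i = 0) -> complex_sum F = F i0.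
Proof.
move=> F0; rewrite /complex_sum !(real_sum_point (i0 := i0)); first by case: (F i0).
  by move=> i /F0 ->.
by move=> i /F0 ->.
Qed.

Definition csummable F := abs_summable (fun i => Normc.normc (F i)).

Lemma normr_Re_le (x : R[i]) : `|complex.Re x| <= Normc.normc x.
Proof. by case: x => a b /=; rewrite -sqrtr_sqr ler_wsqrtr// lerDl sqr_ge0. Qed.

Lemma normr_Im_le (x : R[i]) : `|complex.Im x| <= Normc.normc x.
Proof. by case: x => a b /=; rewrite -sqrtr_sqr ler_wsqrtr// lerDr sqr_ge0. Qed.

Lemma csummable_Re F : csummable F -> abs_summable (fun i => complex.Re (F i)).
Proof.
by apply: abs_summable_le => i; rewrite [leRHS]ger0_norm ?normc_ge0// normr_Re_le.
Qed.

Lemma csummable_Im F : csummable F -> abs_summable (fun i => complex.Im (F i)).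
Proof.
by apply: abs_summable_le => i; rewrite [leRHS]ger0_norm ?normc_ge0// normr_Im_le.
Qed.

Lemma complex_sumD F G : csummable F -> csummable G ->
  complex_sum (fun i => F i + G i) = complex_sum F + complex_sum G.
Proof.
move=> Fs Gs; rewrite /complex_sum.
have -> : (fun i => complex.Re (F i + G i)) =
    fun i => complex.Re (F i) + complex.Re (G i).
  by apply/funext => i; case: (F i) (G i) => ? ? [].
have -> : (fun i => complex.Im (F i + G i)) =
    fun i => complex.Im (F i) + complex.Im (G i).
  by apply/funext => i; case: (F i) (G i) => ? ? [].
rewrite (real_sumD (csummable_Re Fs) (csummable_Re Gs)).
by rewrite (real_sumD (csummable_Im Fs) (csummable_Im Gs)).
Qed.

Lemma complex_sumZ c F : csummable F ->
  complex_sum (fun i => c * F i) = c * complex_sum F.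
Proof.
case: c => a b Fs; have ReF := csummable_Re Fs; have ImF := csummable_Im Fs.
rewrite /complex_sum.
have -> : (fun i => complex.Re ((a +i* b) * F i)) =
    fun i => a * complex.Re (F i) + (- b) * complex.Im (F i).
  by apply/funext => i; case: (F i) => c d /=; rewrite mulNr.
have -> : (fun i => complex.Im ((a +i* b) * F i)) =
    fun i => a * complex.Im (F i) + b * complex.Re (F i).
  by apply/funext => i; case: (F i) => c d /=; rewrite (mulrC b).
rewrite (real_sumD (abs_summableZ a ReF) (abs_summableZ (- b) ImF)).
rewrite (real_sumD (abs_summableZ a ImF) (abs_summableZ b ReF)).
rewrite (real_sumZ a ReF) (real_sumZ (- b) ImF) (real_sumZ a ImF) (real_sumZ b ReF).
by rewrite mulNr; congr Complex; rewrite (mulrC b).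
Qed.

Lemma complex_sum_conj F :
  complex_sum (fun i => (F i)^*) = (complex_sum F)^*.
Proof.
rewrite /complex_sum /=; congr Complex.
  by congr real_sum; apply/funext => i; case: (F i).
rewrite -real_sumN; congr real_sum; apply/funext => i.
by case: (F i).
Qed.

End ComplexSum.

(** * Inner product and norm *)

Section HardyDot.
Variable R : realType.
Implicit Types (f g h : hardy R) (c : R[i]).

Definition normsq f : R := fine (sqnorm f).

Lemma normsq_ge0 f : 0 <= normsq f.
Proof. by rewrite fine_ge0// sqnorm_ge0. Qed.

Lemma normsqE f : (normsq f)%:E = sqnorm f.
Proof. by rewrite fineK// sqnorm_fin. Qed.

Lemma normc_sqr (x : R[i]) : (Normc.normc x ^+ 2)%:C = x * x^*.
Proof.
case: x => a b /=; rewrite sqr_sqrtr ?addr_ge0 ?sqr_ge0//.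
by congr Complex; ring.
Qed.

Lemma hardy_dot_summable f g : csummable (fun i => f i * (g i)^*).
Proof.
rewrite /csummable; suff : abs_summable (fun i => Normc.normc (f i) ^+ 2 + Normc.normc (g i) ^+ 2).
  apply: abs_summable_le => i; rewrite Normc.normcM.
  rewrite ger0_norm ?mulr_ge0 ?normc_ge0// ger0_norm ?addr_ge0 ?sqr_ge0//.
  have -> : Normc.normc (g i)^* = Normc.normc (g i).
    by case: (g i) => a b /=; rewrite sqrrN.
  have := normc_ge0 (f i); have := normc_ge0 (g i).
  move: (Normc.normc _) (Normc.normc _) => a b; nra.
apply: abs_summableD; rewrite /abs_summable.
  rewrite (eq_esum (b := fun i => (Normc.normc (f i) ^+ 2)%:E)).
    exact: (coef_square_summable f).
  by move=> i _; rewrite ger0_norm// sqr_ge0.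
rewrite (eq_esum (b := fun i => (Normc.normc (g i) ^+ 2)%:E)).
  exact: (coef_square_summable g).
by move=> i _; rewrite ger0_norm// sqr_ge0.
Qed.

Lemma dotDl f g h : hardy_dot (f + g) h = hardy_dot f h + hardy_dot g h.
Proof.
rewrite -complex_sumD; [|exact: hardy_dot_summable..].
by congr complex_sum; apply/funext => i; rewrite -mulrDl.
Qed.

Lemma dotZl c f g : hardy_dot (c *: f) g = c * hardy_dot f g.
Proof.
rewrite -complex_sumZ; last exact: hardy_dot_summable.
by congr complex_sum; apply/funext => i; rewrite mulrA.
Qed.

Lemma dotC f g : hardy_dot g f = (hardy_dot f g)^*.
Proof.
rewrite -complex_sum_conj; congr complex_sum; apply/funext => i.
by rewrite conjCM conjCK mulrC.
Qed.

Lemma dotDr f g h : hardy_dot h (f + g) = hardy_dot h f + hardy_dot h g.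
Proof. by rewrite dotC dotDl conjCD -!dotC. Qed.

Lemma dotZr c f g : hardy_dot g (c *: f) = c^* * hardy_dot g f.
Proof. by rewrite dotC dotZl conjCM -dotC. Qed.

Lemma dot0l f : hardy_dot 0 f = 0.
Proof. by rewrite -(scale0r 0) dotZl mul0r. Qed.

Lemma dot0r f : hardy_dot f 0 = 0.
Proof. by rewrite dotC dot0l conjC0. Qed.

Lemma dotNl f g : hardy_dot (- f) g = - hardy_dot f g.
Proof. by rewrite -scaleN1r dotZl mulN1r. Qed.

Lemma dotNr f g : hardy_dot f (- g) = - hardy_dot f g.
Proof. by rewrite dotC dotNl conjCN -dotC. Qed.

Lemma dotBl f g h : hardy_dot (f - g) h = hardy_dot f h - hardy_dot g h.
Proof. by rewrite dotDl dotNl. Qed.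

Lemma dotBr f g h : hardy_dot h (f - g) = hardy_dot h f - hardy_dot h g.
Proof. by rewrite dotDr dotNr. Qed.

Lemma dot_suml n (F : 'I_n -> hardy R) h :
  hardy_dot (\sum_(i < n) F i) h = \sum_(i < n) hardy_dot (F i) h.
Proof.
apply: (big_morph (fun f => hardy_dot f h)) => [f g|]; last exact: dot0l.
exact: dotDl.
Qed.

Lemma dot_self f : hardy_dot f f = (normsq f)%:C.
Proof.
rewrite /hardy_dot /complex_sum.
have -> : (fun i => complex.Re (f i * (f i)^*)) = fun i => Normc.normc (f i) ^+ 2.
  by apply/funext => i; rewrite -normc_sqr.
have -> : (fun i => complex.Im (f i * (f i)^*)) = fun i => 0.
  by apply/funext => i; rewrite -normc_sqr.
rewrite real_sum_ge0; last by move=> i; rewrite sqr_ge0.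
by rewrite (real_sum_point (i0 := (0, 0)%N)).
Qed.

Lemma normsq_eq0 f : normsq f = 0 -> f = 0.
Proof. by move=> f0; apply: hardy_norm_eq0; rewrite /hardy_norm -/(normsq f) f0 sqrtr0. Qed.

Lemma dot_self_eq0 f : hardy_dot f f = 0 -> f = 0.
Proof. by rewrite dot_self => -[/normsq_eq0]. Qed.

Lemma normsqD f g :
  normsq (f + g) = normsq f + normsq g + complex.Re (hardy_dot f g) *+ 2.
Proof.
have : hardy_dot (f + g) (f + g) = hardy_dot f f + hardy_dot g g +
   (hardy_dot f g + (hardy_dot f g)^*).
  by rewrite dotDl !dotDr -dotC; ring.
rewrite !dot_self; case: (hardy_dot f g) => a b [->] _ /=.
by rewrite mulr2n.
Qed.

Lemma normsqZ c f : normsq (c *: f) = Normc.normc c ^+ 2 * normsq f.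
Proof. by rewrite /normsq (sqnormZ c f) fineM ?sqnorm_fin. Qed.

Lemma normsqN f : normsq (- f) = normsq f.
Proof. by rewrite -scaleN1r normsqZ normcN Normc.normc1 expr1n mul1r. Qed.

Lemma normsqB_orth f g : hardy_dot (f - g) g = 0 ->
  normsq f = normsq (f - g) + normsq g.
Proof. by move=> fg; have := normsqD (f - g) g; rewrite subrK fg mul0rn addr0. Qed.

Lemma cauchy_schwarz f g :
  Normc.normc (hardy_dot f g) ^+ 2 <= normsq f * normsq g.
Proof.
have [g0|g_neq0] := eqVneq (normsq g) 0.
  by rewrite (normsq_eq0 g0) dot0r Normc.normc0 expr0n mulr_ge0 ?normsq_ge0.
have g_gt0 : 0 < normsq g by rewrite lt_def g_neq0 normsq_ge0.
(* [c *: g] is the orthogonal projection of f onto the line of g; by Pythagoras its norm is at most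
   that of f. *)
pose c := hardy_dot f g / (normsq g)%:C.
have nc : (normsq g)%:C != 0 by rewrite eq_complex /= (negPf g_neq0).
have orth : hardy_dot (f - c *: g) (c *: g) = 0.
  by rewrite dotZr dotBl dotZl dot_self divfK// subrr mulr0.
have : normsq (c *: g) <= normsq f.
  by rewrite (normsqB_orth orth) lerDr normsq_ge0.
rewrite normsqZ Normc.normcM Normc.normcV exprMn exprVn.
have -> : Normc.normc (normsq g)%:C = normsq g.
  by rewrite /= expr0n addr0 sqrtr_sqr ger0_norm ?normsq_ge0.
rewrite -(ler_pM2r g_gt0); apply: le_trans.
by rewrite le_eqVlt; apply/orP; left; apply/eqP; field.
Qed.

End HardyDot.

(** * Shifts and graded operators *)

Section HardyMaps.
Variable R : realType.
Implicit Types (f g h : hardy R) (c : R[i]) (s : nat -> R[i]).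

Lemma hardyP f g : (forall i, f i = g i) -> f = g.
Proof. by move=> fg; apply/val_inj/funext. Qed.

Lemma hardyDE f g i : (f + g) i = f i + g i. Proof. by []. Qed.
Lemma hardyNE f i : (- f) i = - f i. Proof. by []. Qed.
Lemma hardyZE c f i : (c *: f) i = c * f i. Proof. by []. Qed.
Lemma hardy0E i : (0 : hardy R) i = 0. Proof. by []. Qed.

Lemma hardy_sumE n (F : 'I_n -> hardy R) i : (\sum_(j < n) F j) i = \sum_(j < n) F j i.
Proof. by apply: (big_morph (fun f : hardy R => f i)). Qed.

Lemma mulz_is_linear : linear (@mulz R).
Proof.
move=> c f g; apply: hardyP => -[[|a] b]; last by [].
by rewrite hardyDE hardyZE /= /mulz_coef/= mulr0 addr0.
Qed.

Lemma mulw_is_linear : linear (@mulw R).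
Proof.
move=> c f g; apply: hardyP => -[a [|b]]; last by [].
by rewrite hardyDE hardyZE /= /mulw_coef/= mulr0 addr0.
Qed.

HB.instance Definition _ :=
  GRing.isLinear.Build R[i] (hardy R) (hardy R) _ (@mulz R) mulz_is_linear.
HB.instance Definition _ :=
  GRing.isLinear.Build R[i] (hardy R) (hardy R) _ (@mulw R) mulw_is_linear.

Lemma square_summable_push (e : nat * nat -> nat * nat) f :
  injective e -> (fun i => f (e i)) \in @square_summable R.
Proof.
move=> e_inj; rewrite unfold_in; apply: le_lt_trans (coef_square_summable f).
pose g j := if pselect (range e j) then f j else 0.
rewrite -(@sqnorm_push _ e (fun i => f (e i)) g)//.
- apply: le_esum => j _; rewrite lee_fin /g; case: pselect => // ?.
  by rewrite Normc.normc0 expr0n sqr_ge0.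
- by move=> i; rewrite /g; case: pselect => // -[]; exists i.
- by move=> j je; rewrite /g; case: pselect.
Qed.

Definition succz (i : nat * nat) := (i.1.+1, i.2).
Definition succw (i : nat * nat) := (i.1, i.2.+1).

Lemma succz_inj : injective succz. Proof. by case=> a b [c d] [-> ->]. Qed.
Lemma succw_inj : injective succw. Proof. by case=> a b [c d] [-> ->]. Qed.

(** The backward shifts are the adjoints of [mulz] and [mulw] on the whole Hardy space; compressing
    them to M gives the adjoints of the restrictions. *)
Definition backz f : hardy R := Hardy (square_summable_push f succz_inj).
Definition backw f : hardy R := Hardy (square_summable_push f succw_inj).

Lemma backz_is_linear : linear backz.
Proof. by move=> c f g; apply: hardyP. Qed.

Lemma backw_is_linear : linear backw.
Proof. by move=> c f g; apply: hardyP. Qed.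

HB.instance Definition _ :=
  GRing.isLinear.Build R[i] (hardy R) (hardy R) _ backz backz_is_linear.
HB.instance Definition _ :=
  GRing.isLinear.Build R[i] (hardy R) (hardy R) _ backw backw_is_linear.

Lemma hardy_mulzK : cancel (@mulz R) backz.
Proof. by move=> f; apply: hardyP => -[]. Qed.

Lemma hardy_mulwK : cancel (@mulw R) backw.
Proof. by move=> f; apply: hardyP => -[]. Qed.

Lemma mulzw f : mulz (mulw f) = mulw (mulz f).
Proof. by apply: hardyP => -[[|a] [|b]]. Qed.

Lemma backw_mulz f : backw (mulz f) = mulz (backw f).
Proof. by apply: hardyP => -[[|a] b]. Qed.

Lemma backzw f : backz (backw f) = backw (backz f).
Proof. by apply: hardyP => -[]. Qed.

Lemma dot_mulz f g : hardy_dot (mulz f) g = hardy_dot f (backz g).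
Proof.
apply: (complex_sum_push succz_inj) => [[]//|] [[|a] b] ab.
  by rewrite /= /mulz_coef/= mul0r.
by case: ab; exists (a, b).
Qed.

Lemma dot_mulw f g : hardy_dot (mulw f) g = hardy_dot f (backw g).
Proof.
apply: (complex_sum_push succw_inj) => [[]//|] [a [|b]] ab.
  by rewrite /= /mulw_coef/= mul0r.
by case: ab; exists (a, b).
Qed.

Lemma dot_mulzr f g : hardy_dot f (mulz g) = hardy_dot (backz f) g.
Proof. by rewrite dotC dot_mulz -dotC. Qed.

Lemma dot_mulwr f g : hardy_dot f (mulw g) = hardy_dot (backw f) g.
Proof. by rewrite dotC dot_mulw -dotC. Qed.

Lemma dot_mulzz f g : hardy_dot (mulz f) (mulz g) = hardy_dot f g.
Proof. by rewrite dot_mulz hardy_mulzK. Qed.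

Lemma dot_mulww f g : hardy_dot (mulw f) (mulw g) = hardy_dot f g.
Proof. by rewrite dot_mulw hardy_mulwK. Qed.

Lemma normsq_backz f : normsq (backz f) <= normsq f.
Proof.
have orth : hardy_dot (f - mulz (backz f)) (mulz (backz f)) = 0.
  by rewrite dotBl dot_mulzz dot_mulzr subrr.
rewrite (normsqB_orth orth).
suff <- : normsq (mulz (backz f)) = normsq (backz f) by rewrite lerDr normsq_ge0.
by have [] : (normsq (mulz (backz f)))%:C = (normsq (backz f))%:C
  by rewrite -!dot_self dot_mulzz.
Qed.

Lemma normsq_backw f : normsq (backw f) <= normsq f.
Proof.
have orth : hardy_dot (f - mulw (backw f)) (mulw (backw f)) = 0.
  by rewrite dotBl dot_mulww dot_mulwr subrr.
rewrite (normsqB_orth orth).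
suff <- : normsq (mulw (backw f)) = normsq (backw f) by rewrite lerDr normsq_ge0.
by have [] : (normsq (mulw (backw f)))%:C = (normsq (backw f))%:C
  by rewrite -!dot_self dot_mulww.
Qed.

Lemma normsq_mulz f : normsq (mulz f) = normsq f.
Proof.
by have [] : (normsq (mulz f))%:C = (normsq f)%:C by rewrite -!dot_self dot_mulzz.
Qed.

Lemma normsq_mulw f : normsq (mulw f) = normsq f.
Proof.
by have [] : (normsq (mulw f))%:C = (normsq f)%:C by rewrite -!dot_self dot_mulww.
Qed.

Definition bounded_coefs s := exists B : R, forall n, Normc.normc (s n) ^+ 2 <= B.

Lemma graded_square_summable s f : bounded_coefs s ->
  (fun i => s (i.1 + i.2)%N * f i) \in @square_summable R.
Proof.
case=> B sB; rewrite unfold_in; have B0 : 0 <= B by apply: le_trans (sB 0%N); rewrite sqr_ge0.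
apply: (@le_lt_trans _ _ (B%:E * sqnorm f)%E); last first.
  by rewrite lte_mul_pinfty//; exact: (coef_square_summable f).
rewrite /sqnorm -ge0_esumZ//; last by move=> i; rewrite lee_fin sqr_ge0.
apply: le_esum => i _; rewrite -EFinM lee_fin Normc.normcM exprMn.
by rewrite ler_wpM2r// sqr_ge0.
Qed.

(** Functions of the degree. They provide the projections onto one degree, the truncations, and the
    degree-dependent coefficients of the resolvent. *)
Definition graded s (sb : bounded_coefs s) f : hardy R :=
  Hardy (graded_square_summable f sb).

Lemma gradedE s (sb : bounded_coefs s) f i : graded sb f i = s (i.1 + i.2)%N * f i.
Proof. by []. Qed.

Lemma graded_is_linear s (sb : bounded_coefs s) : linear (graded sb).
Proof.
move=> c f g; apply: hardyP => i.
by rewrite hardyDE hardyZE !gradedE hardyDE hardyZE; ring.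
Qed.

HB.instance Definition _ s (sb : bounded_coefs s) :=
  GRing.isLinear.Build R[i] (hardy R) (hardy R) _ (graded sb) (graded_is_linear sb).

Lemma graded_bounded s (sb : bounded_coefs s) :
  exists B, forall f, normsq (graded sb f) <= B * normsq f.
Proof.
have [B sB] := sb; have B0 : 0 <= B by apply: le_trans (sB 0%N); rewrite sqr_ge0.
exists B => f; rewrite -lee_fin EFinM !normsqE.
rewrite /sqnorm -ge0_esumZ//; last by move=> i; rewrite lee_fin sqr_ge0.
apply: le_esum => i _; rewrite -EFinM lee_fin Normc.normcM exprMn.
by rewrite ler_wpM2r// sqr_ge0.
Qed.

Lemma bounded_coefs_conj s : bounded_coefs s -> bounded_coefs (fun n => (s n)^*).
Proof.
case=> B sB; exists B => n; apply: le_trans (sB n).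
by case: (s n) => a b /=; rewrite sqrrN.
Qed.

Lemma dot_graded s (sb : bounded_coefs s) f g :
  hardy_dot (graded sb f) g = hardy_dot f (graded (bounded_coefs_conj sb) g).
Proof.
congr complex_sum; apply/funext => i.
by rewrite !gradedE conjCM conjCK mulrCA mulrA.
Qed.

Definition homogeneous (N : nat) f : Prop := forall i, (i.1 + i.2)%N != N -> f i = 0.

Lemma graded_homogeneous s (sb : bounded_coefs s) N f :
  homogeneous N f -> graded sb f = s N *: f.
Proof.
move=> fN; apply: hardyP => i; rewrite gradedE hardyZE.
by have [->//|/fN ->] := eqVneq (i.1 + i.2)%N N; rewrite !mulr0.
Qed.

Lemma dot_graded_homogeneous s (sb : bounded_coefs s) N f g :
  homogeneous N g -> hardy_dot (graded sb f) g = s N * hardy_dot f g.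
Proof. by move=> gN; rewrite dot_graded (graded_homogeneous _ gN) dotZr conjCK. Qed.

Lemma dot_homogeneous N N' f g : N != N' ->
  homogeneous N f -> homogeneous N' g -> hardy_dot f g = 0.
Proof.
move=> NN' fN gN; have fg0 i : f i * (g i)^* = 0.
  have [iN|/fN ->] := eqVneq (i.1 + i.2)%N N; last by rewrite mul0r.
  by rewrite gN ?iN// conjC0 mulr0.
by rewrite /hardy_dot (complex_sum_point (i0 := (0, 0)%N)).
Qed.

Lemma homogeneousD N f g : homogeneous N f -> homogeneous N g -> homogeneous N (f + g).
Proof. by move=> fN gN i iN; rewrite hardyDE fN// gN// addr0. Qed.

Lemma homogeneousZ N c f : homogeneous N f -> homogeneous N (c *: f).
Proof. by move=> fN i iN; rewrite hardyZE fN// mulr0. Qed.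

Lemma homogeneous_mulz N f : homogeneous N f -> homogeneous N.+1 (mulz f).
Proof. by move=> fN [[|a] b] // ab; apply: fN; apply: contra ab => /eqP <-. Qed.

Lemma homogeneous_mulw N f : homogeneous N f -> homogeneous N.+1 (mulw f).
Proof.
by move=> fN [a [|b]] // ab; apply: fN; apply: contra ab => /eqP <- /=; rewrite addnS.
Qed.

Lemma bounded_coefs_pred (P : pred nat) : bounded_coefs (fun n => (P n)%:R).
Proof.
exists 1 => n; case: (P n); first by rewrite Normc.normc1 expr1n.
by rewrite Normc.normc0 expr0n ler01.
Qed.

Definition component (N : nat) f : hardy R :=
  graded (bounded_coefs_pred (pred1 N)) f.

Lemma componentE N f i : component N f i = if (i.1 + i.2 == N)%N then f i else 0.
Proof.
by rewrite /component gradedE /=; case: ifP => _; rewrite ?mul1r ?mul0r.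
Qed.

Lemma dot_component N f g : homogeneous N g ->
  hardy_dot (component N f) g = hardy_dot f g.
Proof. by move=> gN; rewrite /component (dot_graded_homogeneous _ _ gN)/= eqxx mul1r. Qed.

End HardyMaps.

(** * Density and projections *)

Section HardyTopology.
Variable R : realType.
Implicit Types (f g h x y : hardy R) (c : R[i]) (A B : set (hardy R)).

Lemma hardy_normE f : `|f| = (Num.sqrt (normsq f))%:C.
Proof. by []. Qed.

Lemma hardy_norm_ltE f (e : R) : 0 < e -> (`|f| < e%:C) = (normsq f < e ^+ 2).
Proof.
move=> e0; rewrite hardy_normE ltcR -{1}(ger0_norm (ltW e0)) -sqrtr_sqr.
by rewrite ltr_sqrt// exprn_gt0.
Qed.

Lemma closureP A x :
  closure A x <-> forall e : R, 0 < e -> exists2 y, A y & normsq (x - y) < e.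
Proof.
split=> [Ax e e0|Ax B /nbhs_ballP[e /= e0 eB]].
  have se0 : 0 < (Num.sqrt e)%:C by rewrite ltcR sqrtr_gt0.
  have [y [Ay]] := Ax _ (nbhsx_ballx x _ se0).
  rewrite -ball_normE /ball_/= hardy_norm_ltE ?sqrtr_gt0// sqr_sqrtr ?ltW//.
  by move=> xy; exists y.
(* The radius of the ball is a scalar in R[i]; being positive, it is real. *)
have [r er] : exists r, e = r%:C.
  by apply/complex_realP; rewrite realE ltW.
move: e0; rewrite er ltcR => r0.
have [y Ay xy] := Ax (r ^+ 2) (exprn_gt0 _ r0).
exists y; split => //; apply: eB.
by rewrite -ball_normE /ball_/= er hardy_norm_ltE.
Qed.

Lemma bounded_continuous (T : {linear hardy R -> hardy R}) (K : R) :
  (forall f, normsq (T f) <= K * normsq f) -> continuous T.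
Proof.
move=> TK; apply: bounded_linear_continuous; apply/bounded_funP => r.
exists ((Num.sqrt `|K|)%:C * `|r|) => f fr; apply: (@le_trans _ _ ((Num.sqrt `|K|)%:C * `|f|)).
  rewrite !hardy_normE -rmorphM lecR -sqrtrM//; apply: ler_wsqrtr.
  by apply: le_trans (TK f) _; rewrite ler_wpM2r ?normsq_ge0// ler_norm.
rewrite ler_wpM2l ?ler0c ?sqrtr_ge0// (le_trans fr)// real_ler_norm//.
by apply: ger0_real; apply: le_trans fr.
Qed.

Definition lin_subspace A := A 0 /\ forall c x y, A x -> A y -> A (c *: x + y).

Lemma lin_subspaceD A x y : lin_subspace A -> A x -> A y -> A (x + y).
Proof. by case=> _ AL Ax Ay; rewrite -(scale1r x); exact: AL. Qed.

Lemma lin_subspaceZ A c x : lin_subspace A -> A x -> A (c *: x).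
Proof. by case=> A0 AL Ax; rewrite -(addr0 (_ *: _)); exact: AL. Qed.

Lemma lin_subspaceN A x : lin_subspace A -> A x -> A (- x).
Proof. by move=> AS Ax; rewrite -scaleN1r; exact: lin_subspaceZ. Qed.

Lemma lin_subspaceB A x y : lin_subspace A -> A x -> A y -> A (x - y).
Proof. by move=> AS Ax Ay; apply: lin_subspaceD => //; exact: lin_subspaceN. Qed.

Lemma lin_subspace_sum A n (F : 'I_n -> hardy R) :
  lin_subspace A -> (forall i, A (F i)) -> A (\sum_(i < n) F i).
Proof.
move=> AS AF; apply: (big_ind A) => //; first by case: AS.
by move=> x y; exact: lin_subspaceD.
Qed.

Lemma normsqD_le f g : normsq (f + g) <= 2 * (normsq f + normsq g).
Proof.
have := normsq_ge0 (f - g); rewrite !normsqD normsqN dotNr.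
case: (hardy_dot f g) => a b /=; rewrite !mulr2n; lra.
Qed.

Lemma lin_subspace_closure A : lin_subspace A -> lin_subspace (closure A).
Proof.
move=> AS; split; first by apply: subset_closure; case: AS.
move=> c x y /closureP Ax /closureP Ay; apply/closureP => e e0.
pose n := Normc.normc c ^+ 2; have n0 : 0 <= n by rewrite sqr_ge0.
have n1 : 0 < n + 1 by rewrite ltr_wpDl.
have d0 : 0 < e / (4 * (n + 1)) by rewrite divr_gt0// mulr_gt0.
have [x' Ax' xx'] := Ax _ d0.
have e4 : 0 < e / 4 by rewrite divr_gt0.
have [y' Ay' yy'] := Ay _ e4.
exists (c *: x' + y'); first by case: AS => _; apply.
have -> : c *: x + y - (c *: x' + y') = c *: (x - x') + (y - y').
  by rewrite scalerBr opprD addrACA.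
apply: le_lt_trans (normsqD_le _ _) _; rewrite normsqZ -/n.
have : n * normsq (x - x') <= n * (e / (4 * (n + 1))) by rewrite ler_wpM2l// ltW.
have : n * (e / (4 * (n + 1))) <= e / 4.
  have -> : n * (e / (4 * (n + 1))) = (e / 4) * (n / (n + 1)).
    by field; rewrite gt_eqF.
  by rewrite ler_piMr ?ltW// ltr_pdivrMr// mul1r ltrDl.
lra.
Qed.

Lemma closure_bounded_image (T : {linear hardy R -> hardy R}) (K : R) A B :
    (forall f, normsq (T f) <= K * normsq f) ->
    (forall x, A x -> B (T x)) -> forall x, closure A x -> closure B (T x).
Proof.
move=> TK AB x /closureP Ax; apply/closureP => e e0.
have K1 : 0 < `|K| + 1 by rewrite ltr_wpDl.
have [y Ay xy] := Ax (e / (`|K| + 1)) (divr_gt0 e0 K1).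
exists (T y); first exact: AB.
rewrite -linearB; apply: le_lt_trans (TK _) _.
apply: (@le_lt_trans _ _ ((`|K| + 1) * normsq (x - y))).
  rewrite ler_wpM2r ?normsq_ge0//; have := ler_norm K; lra.
by rewrite mulrC -ltr_pdivlMr.
Qed.

Lemma orth_closure A f : (forall h, A h -> hardy_dot f h = 0) ->
  forall h, closure A h -> hardy_dot f h = 0.
Proof.
move=> fA h /closureP Ah; apply: Normc.eq0_normc; apply/eqP.
rewrite -sqrf_eq0 eq_le sqr_ge0 andbT; apply/ler_addgt0Pr => e e0; rewrite add0r.
have f1 : 0 < normsq f + 1 by rewrite ltr_wpDl ?normsq_ge0.
have [y Ay hy] := Ah (e / (normsq f + 1)) (divr_gt0 e0 f1).
have -> : hardy_dot f h = hardy_dot f (h - y) by rewrite dotBr (fA y)// subr0.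
apply: le_trans (cauchy_schwarz _ _) _.
apply: (@le_trans _ _ ((normsq f + 1) * normsq (h - y))).
  by rewrite ler_wpM2r ?normsq_ge0// lerDl.
by rewrite mulrC -ler_pdivlMr// ltW.
Qed.

(* Gram-Schmidt on a finite list; the bi-orthogonality clause replaces
   membership in the span. *)
Lemma finite_projection (L : set (hardy R)) (s : seq (hardy R)) f :
    lin_subspace L -> (forall x, x \in s -> L x) ->
  exists m, [/\ L m, forall x, x \in s -> hardy_dot (f - m) x = 0 &
    forall y, (forall x, x \in s -> hardy_dot y x = 0) -> hardy_dot y m = 0].
Proof.
move=> LS; elim: s f => [|x s IH] f Ls.
  by exists 0; split=> [|//|y _]; [case: LS|exact: dot0r].
have {}Ls' y : y \in s -> L y by move=> ys; apply: Ls; rewrite inE ys orbT.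
have [m [Lm fm mo]] := IH f Ls'; have [n [Ln xn no]] := IH x Ls'.
pose x' := x - n; pose a := hardy_dot (f - m) x' / hardy_dot x' x'.
exists (m + a *: x').
have Lx' : L x' by apply: lin_subspaceB => //; apply: Ls; rewrite mem_head.
have orth_s y : y \in s -> hardy_dot (f - (m + a *: x')) y = 0.
  by move=> ys; rewrite opprD addrA dotBl dotZl fm// xn// mulr0 subr0.
have orth_x' : hardy_dot (f - (m + a *: x')) x' = 0.
  rewrite opprD addrA dotBl dotZl /a.
  (* When x adds nothing new to the span of s, x' is 0 and every claim about it is trivial. *)
  have [x'0|x'0] := eqVneq (hardy_dot x' x') 0.
    by rewrite (dot_self_eq0 x'0) !dot0r mulr0 subr0.
  by rewrite divfK// subrr.
split=> [|y|y yo]; first by apply: lin_subspaceD => //; exact: lin_subspaceZ.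
  rewrite inE => /predU1P[->|]; last exact: orth_s.
  have -> : x = x' + n by rewrite subrK.
  by rewrite dotDr orth_x' (no _ orth_s) addr0.
have ys z : z \in s -> hardy_dot y z = 0 by move=> zs; apply: yo; rewrite inE zs orbT.
by rewrite dotDr (mo _ ys) dotZr dotBr (no _ ys) yo ?mem_head// subrr mulr0 addr0.
Qed.

Lemma sqnorm_components f :
  sqnorm f = \esum_(N in [set: nat]) sqnorm (component N f).
Proof.
pose J (N : nat) := [set i : nat * nat | (i.1 + i.2)%N = N].
rewrite /sqnorm (_ : [set: nat * nat] = \bigcup_(N in [set: nat]) J N); last first.
  by apply/seteqP; split => // i _; exists (i.1 + i.2)%N.
rewrite esum_bigcupT => [|N N' _ _ [i [<- <-]]//|i]; last by rewrite lee_fin sqr_ge0.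
apply: eq_esum => N _; rewrite esum_mkcond.
rewrite (_ : \bigcup_(N in [set: nat]) J N = [set: nat * nat]); last first.
  by apply/seteqP; split => // i _; exists (i.1 + i.2)%N.
apply: eq_esum => i _; rewrite componentE; have [iN|iN] := eqVneq.
  by rewrite mem_set.
by rewrite memNset ?Normc.normc0 ?expr0n// => /eqP; exact/negP.
Qed.

Definition truncation L f : hardy R :=
  graded (bounded_coefs_pred R (fun n => (n < L)%N)) f.

Lemma truncationE L f : truncation L f = \sum_(N < L) component N f.
Proof.
apply: hardyP => i; rewrite hardy_sumE /truncation gradedE.
under eq_bigr do rewrite componentE.
have [iL|Li] := ltnP (i.1 + i.2)%N L.
  rewrite (bigD1 (Ordinal iL))//= eqxx big1 ?addr0 ?mul1r// => j /negPf jN.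
  by case: ifP => // /eqP iN; move: jN; rewrite -(inj_eq val_inj)/= iN eqxx.
rewrite mul0r big1// => j _; rewrite ifN//.
by rewrite neq_ltn (leq_trans (ltn_ord j) Li) orbT.
Qed.

(** A finite set of coefficients carries all but e of the squared norm and lies below some degree L;
    the truncation carries at least as much, and Pythagoras bounds the rest. *)
Lemma truncation_approx f (e : R) : 0 < e -> exists L, normsq (f - truncation L f) < e.
Proof.
move=> e0.
have : ((normsq f - e)%:E < sqnorm f)%E by rewrite -normsqE lte_fin gtrBl.
rewrite {1}/sqnorm => /ereal_sup_gt[_ [X [finX _] <-]] Xe.
have [L XL] : exists L, forall i, X i -> (i.1 + i.2 < L)%N.
  have /finite_seqP[s ->] := finX.
  by exists (\sum_(i <- s) (i.1 + i.2).+1)%N => i /= si; rewrite (big_rem i)//= ltn_addr.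
exists L.
have orth : hardy_dot (f - truncation L f) (truncation L f) = 0.
  rewrite /hardy_dot (complex_sum_point (i0 := (0, 0)%N)).
    rewrite hardyDE hardyNE /truncation gradedE/=; case: (_ < _)%N => /=.
      by rewrite mul1r subrr mul0r.
    by rewrite mul0r conjC0 mulr0.
  move=> i _; rewrite hardyDE hardyNE /truncation gradedE/=; case: (_ < _)%N => /=.
    by rewrite mul1r subrr mul0r.
  by rewrite mul0r conjC0 mulr0.
have fE := normsqB_orth orth.
suff : normsq f - e < normsq (truncation L f) by lra.
rewrite -lte_fin; apply: lt_le_trans Xe _; rewrite normsqE.
apply: (@le_trans _ _ (\sum_(i \in X) (Normc.normc (truncation L f i) ^+ 2)%:E)%E); last first.
  by apply: esum_ge; exists X.
rewrite le_eqVlt; apply/orP; left; apply/eqP; apply: eq_fsbigr => i /set_mem Xi.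
by rewrite /truncation gradedE XL// mul1r.
Qed.

End HardyTopology.

(** * Finite differences of products of binomials *)

Section BinomialSums.
Variable K : comNzRingType.

(* The n-th finite difference at 0 of the polynomial in l
   [C(x + l, r) C(y - l, s)], of degree r + s. *)
Definition bin_diff (n r s x y : nat) : K :=
  \sum_(l < n.+1) (-1) ^+ l * ('C(n, l) * ('C(x + l, r) * 'C(y - l, s)))%:R.

Lemma sum_binS n (F : nat -> K) :
  \sum_(l < n.+2) (-1) ^+ l * 'C(n.+1, l)%:R * F l =
  \sum_(l < n.+1) (-1) ^+ l * 'C(n, l)%:R * (F l - F l.+1).
Proof.
rewrite big_ord_recl /= expr0 bin0 mul1r.
under eq_bigr do rewrite /= binS natrD mulrDr mulrDl.
rewrite big_split /= big_ord_recr /= bin_small// mulr0 mul0r addr0.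
rewrite [RHS](eq_bigr (fun l : 'I_n.+1 => (-1) ^+ l * 'C(n, l)%:R * F l +
   (-1) ^+ l.+1 * 'C(n, l)%:R * F l.+1)); last first.
  by move=> l _; rewrite exprS; ring.
rewrite big_split /= addrA; congr (_ + _).
by rewrite [RHS]big_ord_recl /= expr0 bin0 mul1r.
Qed.

(** By Pascal's rule one difference step turns the product into a difference of two such products,
    with s or r lowered by one. The bound [n <= y] keeps the truncated subtraction y - l exact on
    the whole range. *)
Lemma bin_diff_eq0 n r s x y : (r + s < n)%N -> (n <= y)%N -> bin_diff n r s x y = 0.
Proof.
elim: n r s x y => // n IH r s x [//|y]; rewrite !ltnS => rs ny.
have E l : (l < n.+1)%N ->
    ('C(x + l, r) * 'C(y.+1 - l, s))%:R - ('C(x + l.+1, r) * 'C(y.+1 - l.+1, s))%:R =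
    (if s is s'.+1 then ('C(x + l, r) * 'C(y - l, s'))%:R else 0) -
    (if r is r'.+1 then ('C(x + l, r') * 'C(y - l, s))%:R else 0) :> K.
  move=> ln; have ly : (l <= y)%N by rewrite (leq_trans _ ny).
  rewrite subSn// subSS addnS.
  by case: r s {rs} => [|r] [|s]; rewrite ?bin0 ?binS; ring.
rewrite /bin_diff; under eq_bigr do rewrite natrM mulrA.
rewrite (sum_binS n (fun l => ('C(x + l, r) * 'C(y.+1 - l, s))%:R)).
under eq_bigr => l _ do rewrite E// mulrBr.
rewrite sumrB; apply/eqP; rewrite subr_eq0; apply/eqP.
transitivity (0 : K).
  case: s rs {E} => [|s] rs; first by rewrite big1// => l _; rewrite mulr0.
  have rs' : (r + s < n)%N by rewrite -addnS.
  rewrite -[RHS](IH r s x y rs' ny).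
  by rewrite /bin_diff; apply: eq_bigr => l _; rewrite [in RHS]natrM mulrA.
case: r rs {E} => [|r] rs; first by rewrite big1// => l _; rewrite mulr0.
apply: esym; rewrite -[RHS](IH r s x y rs ny).
by rewrite /bin_diff; apply: eq_bigr => l _; rewrite [in RHS]natrM mulrA.
Qed.

(* The same difference with the factor [C(l - 1, r)], whose value at l = 0 is
   (-1)^r for the polynomial but is left out of the sum. *)
Lemma bin_diff_pred n r s y : (r + s < n)%N -> (n <= y)%N ->
  \sum_(l < n) (-1) ^+ l.+1 * ('C(n, l.+1) * ('C(l, r) * 'C(y - l.+1, s)))%:R =
  (-1) ^+ r.+1 * 'C(y, s)%:R :> K.
Proof.
move=> rsn ny; elim: r rsn => [|r IH] rsn.
  have := @bin_diff_eq0 n 0 s 0 y rsn ny; rewrite /bin_diff big_ord_recl /=.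
  rewrite expr0 !bin0 subn0 !mul1n mul1r => /eqP; rewrite addrC addr_eq0 => /eqP E.
  rewrite expr1 mulN1r -E; apply: eq_bigr => l _.
  by rewrite !bin0.
(* Pascal's rule splits C(l + 1, r + 1) into C(l, r + 1) + C(l, r). The full difference vanishes and
   so does its term at 0, hence the sums for r + 1 and for r are opposite. *)
have := @bin_diff_eq0 n r.+1 s 0 y rsn ny; rewrite /bin_diff big_ord_recl /=.
rewrite addn0 bin0n mul0n muln0 mulr0 add0r.
rewrite (eq_bigr (fun l : 'I_n =>
    (-1) ^+ l.+1 * ('C(n, l.+1) * ('C(l, r.+1) * 'C(y - l.+1, s)))%:R +
    (-1) ^+ l.+1 * ('C(n, l.+1) * ('C(l, r) * 'C(y - l.+1, s)))%:R)); last first.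
  by move=> l _; rewrite add0n binS mulnDl mulnDr natrD mulrDr.
rewrite big_split /= IH; last by rewrite ltnW.
by move=> /eqP; rewrite addr_eq0 => /eqP ->; rewrite [in RHS]exprS; ring.
Qed.

(** The reflection l -> n - l of [bin_diff_pred], with the two binomials exchanged: the omitted term
    is now the one at l = n, where the polynomial C(n - 1 - l, s) takes the value (-1)^s. *)
Lemma bin_diff_last n r s x : (r + s < n)%N ->
  \sum_(l < n) (-1) ^+ l * ('C(n, l) * ('C(x + l, r) * 'C(n - l.+1, s)))%:R =
  (-1) ^+ (n + s).+1 * 'C(x + n, r)%:R :> K.
Proof.
move=> rsn.
have := @bin_diff_pred n s r (x + n) _ (leq_addl _ _); rewrite addnC => /(_ rsn) E.
transitivity ((-1) ^+ n * ((-1) ^+ s.+1 * 'C(x + n, r)%:R) : K); last first.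
  by rewrite -addnS exprD mulrA.
rewrite -E mulr_sumr (reindex_inj rev_ord_inj)/=; apply: eq_bigr => l _.
have ln := ltn_ord l; rewrite mulrA -exprD.
have -> : (n - (n - l.+1).+1 = l)%N by lia.
have -> : (x + (n - l.+1) = x + n - l.+1)%N by lia.
rewrite (_ : 'C(n, n - l.+1) = 'C(n, l.+1)) ?bin_sub//.
rewrite [('C(x + n - _, _) * _)%N]mulnC.
congr (_ * _); apply/eqP; rewrite -signr_odd -[X in _ == X]signr_odd.
by rewrite oddB// oddD.
Qed.

End BinomialSums.

(** * The core operator of a graded submodule *)

(* [gens_total] says that the closed span of the generators contains A. *)
Record graded_submodule (R : realType) (A : set (hardy R))
    (gens : nat -> seq (hardy R)) : Prop := GradedSubmodule {
  graded_lin_subspace : lin_subspace A;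
  gens_mem : forall N x, x \in gens N -> A x;
  gens_homogeneous : forall N x, x \in gens N -> homogeneous N x;
  gens_total : forall f, (forall N x, x \in gens N -> hardy_dot f x = 0) ->
    forall h, A h -> hardy_dot f h = 0;
  graded_mulz : forall x, A x -> A (mulz x);
  graded_mulw : forall x, A x -> A (mulw x) }.

Section GradedSubmodule.
Variables (R : realType) (A : set (hardy R)) (gens : nat -> seq (hardy R)).
Implicit Types (f g h x y m : hardy R).
Hypothesis hA : graded_submodule A gens.

Local Notation M := (closure A).

Let M_subspace : lin_subspace M. Proof. exact: (lin_subspace_closure (graded_lin_subspace hA)). Qed.

Let sub_AM x : A x -> M x. Proof. exact: subset_closure. Qed.

Lemma gens_orth f : (forall N x, x \in gens N -> hardy_dot f x = 0) ->
  forall h, M h -> hardy_dot f h = 0.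
Proof. by move=> fx; apply: orth_closure; exact: (gens_total hA). Qed.

Lemma gens_eq f g : M f -> M g ->
  (forall N x, x \in gens N -> hardy_dot f x = hardy_dot g x) -> f = g.
Proof.
move=> Mf Mg fg; apply/eqP; rewrite -subr_eq0; apply/eqP/dot_self_eq0.
apply: gens_orth; last exact: (lin_subspaceB M_subspace Mf Mg).
by move=> N x /fg; rewrite dotBl => ->; rewrite subrr.
Qed.

Let component_projection f N : exists m, [/\ A m, homogeneous N m,
  forall x, x \in gens N -> hardy_dot (component N f - m) x = 0 &
  normsq m <= normsq (component N f)].
Proof.
have LS : lin_subspace [set x | A x /\ homogeneous N x].
  split=> [|c x y [Ax Nx] [Ay Ny]]; first by split=> //; case: (graded_lin_subspace hA).
  split; first by case: (graded_lin_subspace hA) => _; apply.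
  by apply: homogeneousD => //; exact: homogeneousZ.
have Lg x : x \in gens N -> [set x | A x /\ homogeneous N x] x.
  by move=> xN; split; [exact: (gens_mem hA xN)|exact: (gens_homogeneous hA)].
have [m [[Am Nm] fm mo]] := finite_projection (component N f) LS Lg.
exists m; split => //.
(* The difference between the component and m is orthogonal to the generators, so the
   bi-orthogonality clause makes it orthogonal to m itself. *)
by rewrite (normsqB_orth (mo _ fm)) lerDr normsq_ge0.
Qed.

(** The projections of the components of f are glued by reading each coefficient in its own degree.
    Squared norms add up over the degrees and no projection increases them, so the result is square
    summable; its truncations lie in A, so it lies in M. *)
Lemma projection_exists f :
  exists m, M m /\ forall h, M h -> hardy_dot (f - m) h = 0.
Proof.
have [mN mNP] := choice (component_projection f).
pose m0 (i : nat * nat) : R[i] := mN (i.1 + i.2)%N i.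
have mE N : (fun i => if (i.1 + i.2 == N)%N then m0 i else 0) = mN N.
  apply/funext => i; have [<-//|iN] := eqVneq (i.1 + i.2)%N N.
  by have [_ -> //] := mNP N.
have m_ss : m0 \in @square_summable R.
  rewrite unfold_in; apply: le_lt_trans (coef_square_summable f).
  pose J (N : nat) := [set i : nat * nat | (i.1 + i.2)%N = N].
  have JT : [set: nat * nat] = \bigcup_(N in [set: nat]) J N.
    by apply/seteqP; split => // i _; exists (i.1 + i.2)%N.
  rewrite sqnorm_components /sqnorm {1}JT.
  rewrite esum_bigcupT => [|N N' _ _ [i [<- <-]]//|i]; last by rewrite lee_fin sqr_ge0.
  apply: le_esum => N _; have [_ _ _] := mNP N; rewrite -lee_fin !normsqE.
  apply: le_trans; rewrite -[X in (_ <= sqnorm X)%E]mE /sqnorm.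
  rewrite esum_mkcond; apply: le_esum => i _; case: (boolP (i \in J N)) => iN.
    by rewrite ifT//; apply/eqP; move/set_mem: iN.
  by rewrite lee_fin sqr_ge0.
pose m := Hardy m_ss.
have mcomp N : component N m = mN N.
  by apply: hardyP => i; rewrite componentE -mE.
have Mm : M m.
  apply/closureP => e /(truncation_approx m)[L mL].
  exists (truncation L m) => //; rewrite truncationE.
  apply: (lin_subspace_sum (graded_lin_subspace hA)) => j; rewrite mcomp.
  by have [] := mNP j.
exists m; split => //; apply: gens_orth => N x xN.
rewrite -(dot_component _ (gens_homogeneous hA xN)) /component linearB/=.
by rewrite -!/(component _ _) mcomp; have [_ _ -> ] := mNP N.
Qed.

Lemma projection_unique f m m' :
    M m -> (forall h, M h -> hardy_dot (f - m) h = 0) ->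
    M m' -> (forall h, M h -> hardy_dot (f - m') h = 0) -> m = m'.
Proof.
move=> Mm fm Mm' fm'; apply: gens_eq => // N x xN.
have Mx : M x by apply: sub_AM; exact: (gens_mem hA xN).
have /eqP := fm _ Mx; have /eqP := fm' _ Mx.
by rewrite !dotBl !subr_eq0 => /eqP <- /eqP <-.
Qed.

Local Notation P := (orth_proj M).

Lemma orth_projP f : M (P f) /\ forall h, M h -> hardy_dot (f - P f) h = 0.
Proof.
have [m mP] := projection_exists f.
exact: (@xgetPex _ 0 [set m | M m /\ forall h, M h -> hardy_dot (f - m) h = 0] (ex_intro _ _ mP)).
Qed.

Lemma orth_proj_mem f : M (P f). Proof. by case: (orth_projP f). Qed.

Arguments orth_proj_mem f : clear implicits.


Lemma orth_proj_eq f m : M m ->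
  (forall h, M h -> hardy_dot f h = hardy_dot m h) -> P f = m.
Proof.
move=> Mm fm; have [MP fP] := orth_projP f; apply: (projection_unique (f := f)) => //.
by move=> h Mh; rewrite dotBl fm// subrr.
Qed.

Lemma orth_proj_id f : M f -> P f = f.
Proof. by move=> Mf; exact: orth_proj_eq. Qed.

Lemma dot_orth_projl f h : M h -> hardy_dot (P f) h = hardy_dot f h.
Proof.
by have [_ fP] := orth_projP f => /fP/eqP; rewrite dotBl subr_eq0 => /eqP.
Qed.

Lemma dot_orth_projr f h : M h -> hardy_dot h (P f) = hardy_dot h f.
Proof. by move=> Mh; rewrite dotC dot_orth_projl// -dotC. Qed.

Lemma dot_orth_proj f g : hardy_dot (P f) g = hardy_dot f (P g).
Proof.
by rewrite -(dot_orth_projr _ (orth_proj_mem f)) dot_orth_projl//; exact: orth_proj_mem.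
Qed.

Lemma orth_proj_is_linear : linear P.
Proof.
move=> c f g; apply: orth_proj_eq => [|h Mh].
  by case: M_subspace => _; apply; exact: orth_proj_mem.
by rewrite !dotDl !dotZl (dot_orth_projl f Mh) (dot_orth_projl g Mh).
Qed.

Lemma normsq_orth_proj f : normsq (P f) <= normsq f.
Proof.
have [MP fP] := orth_projP f.
by rewrite (normsqB_orth (fP _ MP)) lerDr normsq_ge0.
Qed.

Lemma closure_mulz x : M x -> M (mulz x).
Proof.
apply: (@closure_bounded_image _ (@mulz R) 1) => [f|]; last exact: (graded_mulz hA).
by rewrite mul1r normsq_mulz.
Qed.

Lemma closure_mulw x : M x -> M (mulw x).
Proof.
apply: (@closure_bounded_image _ (@mulw R) 1) => [f|]; last exact: (graded_mulw hA).
by rewrite mul1r normsq_mulw.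
Qed.

Lemma adjoint_onE (T T' : hardy R -> hardy R) f :
    (forall h g, hardy_dot (T h) g = hardy_dot h (T' g)) ->
  adjoint_on M T f = P (T' f).
Proof.
move=> TT'; rewrite /adjoint_on; set S := [set _ | _].
have SP : S (P (T' f)).
  split=> [|h Mh]; first exact: orth_proj_mem.
  by rewrite TT' dot_orth_projr.
have [MS fS] : S (xget 0 S) by apply: xgetPex; exists (P (T' f)).
apply/esym/orth_proj_eq => // h Mh.
by rewrite dotC -TT' (fS _ Mh) -dotC.
Qed.

(** The adjoint of a restriction is the backward shift followed by P. Since M is invariant under
    [mulz] and [mulw], the inner projections are absorbed by the outer ones, and one projection
    remains in each term. Linearity, self-adjointness and boundedness follow from this form. *)
Lemma core_operatorE f : core_operator M f =
  P f - mulz (P (backz f)) - mulw (P (backw f)) +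
  mulz (mulw (P (backz (backw f)))).
Proof.
have Pz g : P (backz (P g)) = P (backz g).
  apply: orth_proj_eq => [|h Mh]; first exact: orth_proj_mem.
  by rewrite dot_orth_projl// -!dot_mulzr dot_orth_projl//; exact: closure_mulz.
have Pw g : P (backw (P g)) = P (backw g).
  apply: orth_proj_eq => [|h Mh]; first exact: orth_proj_mem.
  by rewrite dot_orth_projl// -!dot_mulwr dot_orth_projl//; exact: closure_mulw.
rewrite /core_operator.
rewrite !(adjoint_onE _ (@dot_mulz R)) !(adjoint_onE _ (@dot_mulw R)).
have E3 := etrans (congr1 (fun x => P (backz x)) (Pw f)) (Pz (backw f)).
exact: (congr2 +%R (congr2 +%R (congr2 +%R (erefl (P f))
  (congr1 (fun x => - mulz x) (Pz f))) (congr1 (fun x => - mulw x) (Pw f)))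
  (congr1 (fun x => mulz (mulw x)) E3)).
Qed.

Local Opaque orth_proj.

Lemma core_operator_is_linear : linear (core_operator M).
Proof.
have lin4 c (a a' b b' d d' e e' : hardy R) :
    (c *: a + a') - (c *: b + b') - (c *: d + d') + (c *: e + e') =
    c *: (a - b - d + e) + (a' - b' - d' + e').
  apply: hardyP => i; rewrite !(hardyDE, hardyNE, hardyZE).
  move: (a i) (a' i) (b i) (b' i) (d i) (d' i) (e i) (e' i) => *; ring.
have lP := orth_proj_is_linear.
move=> c f g; rewrite (core_operatorE (c *: f + g)) (core_operatorE f) (core_operatorE g).
rewrite -lin4 -lP.
congr (_ - _ - _ + _); rewrite ?backz_is_linear ?backw_is_linear ?backz_is_linear lP.
- exact: mulz_is_linear.
- exact: mulw_is_linear.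
- by rewrite mulw_is_linear mulz_is_linear.
Qed.

Lemma core_operator_mem f : M (core_operator M f).
Proof.
rewrite core_operatorE; apply: (lin_subspaceD M_subspace); last first.
  exact: closure_mulz (closure_mulw (orth_proj_mem _)).
apply: (lin_subspaceB M_subspace); last exact: closure_mulw (orth_proj_mem _).
apply: (lin_subspaceB M_subspace); first exact: orth_proj_mem.
exact: closure_mulz (orth_proj_mem _).
Qed.

Lemma core_operator_selfadjoint f g :
  hardy_dot (core_operator M f) g = hardy_dot f (core_operator M g).
Proof.
rewrite !core_operatorE !dotDl !dotDr !dotNl !dotNr dot_orth_proj.
rewrite (dot_mulz _ g) (dot_mulzr f) (dot_orth_proj (backz f)).
rewrite (dot_mulw _ g) (dot_mulwr f) (dot_orth_proj (backw f)).
rewrite (dot_mulz _ g) (dot_mulw _ (backz g)) (dot_mulzr f) (dot_mulwr (backz f)).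
by rewrite !backzw (dot_orth_proj (backw (backz f))).
Qed.

(** Each of the four terms has squared norm at most that of f; three uses of [normsqD_le] give
    2(2(2(1 + 1) + 1) + 1) = 22. *)
Lemma core_operator_bounded f : normsq (core_operator M f) <= 22 * normsq f.
Proof.
rewrite core_operatorE.
have le4 (a b c d : hardy R) N : normsq a <= N -> normsq b <= N ->
    normsq c <= N -> normsq d <= N -> normsq (a - b - c + d) <= 22 * N.
  have := normsqD_le (a - b - c) d; have := normsqD_le (a - b) (- c).
  have := normsqD_le a (- b); rewrite !normsqN.
  move: (normsq (a - b - c + d)) (normsq (a - b - c)) (normsq (a - b)).
  by move: (normsq a) (normsq b) (normsq c) (normsq d) => *; lra.
apply: le4; rewrite ?normsq_mulz ?normsq_mulw; first exact: normsq_orth_proj.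
- exact: le_trans (normsq_orth_proj (backz f)) (normsq_backz f).
- exact: le_trans (normsq_orth_proj (backw f)) (normsq_backw f).
exact: le_trans (normsq_orth_proj (backz (backw f)))
  (le_trans (normsq_backz (backw f)) (normsq_backw f)).
Qed.

End GradedSubmodule.

(** * The submodule generated by (z - w)^k *)

Section Generators.
Variable R : realType.
Implicit Types (f g h : hardy R) (q : {poly {poly R[i]}}) (c : R[i]).

Local Notation C := R[i].
Local Notation polyz := (polyz R).
Local Notation polyw := (polyw R).

Lemma hardy_of_polyD q q' : hardy_of_poly (q + q') = hardy_of_poly q + hardy_of_poly q'.
Proof. by apply: hardyP => i; rewrite hardyDE /= /poly_coef !coefD. Qed.

Lemma hardy_of_polyN q : hardy_of_poly (- q) = - hardy_of_poly q.
Proof. by apply: hardyP => i; rewrite hardyNE /= /poly_coef !coefN. Qed.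

Lemma hardy_of_polyZ c q : hardy_of_poly (c%:P%:P * q) = c *: hardy_of_poly q.
Proof. by apply: hardyP => i; rewrite hardyZE /= /poly_coef !coefCM. Qed.

Lemma hardy_of_poly0 : hardy_of_poly (0 : {poly {poly C}}) = 0.
Proof. by apply: hardyP => i; rewrite /= /poly_coef !coef0. Qed.

Lemma mulz_hardy_of_poly q : mulz (hardy_of_poly q) = hardy_of_poly (polyz * q).
Proof.
apply: hardyP => -[a b] /=; rewrite /mulz_coef /poly_coef /= /polyz coefCM coefXM.
by case: a.
Qed.

Lemma mulw_hardy_of_poly q : mulw (hardy_of_poly q) = hardy_of_poly (polyw * q).
Proof.
apply: hardyP => -[a b] /=; rewrite /mulw_coef /poly_coef /= /polyw coefXM.
by case: b => //=; rewrite coef0.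
Qed.

Definition pgen k a b : hardy R :=
  hardy_of_poly ((polyz - polyw) ^+ k * (polyz ^+ a * polyw ^+ b)).

Lemma mulz_gen k a b : mulz (pgen k a b) = pgen k a.+1 b.
Proof.
by rewrite /pgen mulz_hardy_of_poly; congr hardy_of_poly; rewrite [in RHS]exprS; ring.
Qed.

Lemma mulw_gen k a b : mulw (pgen k a b) = pgen k a b.+1.
Proof.
by rewrite /pgen mulw_hardy_of_poly; congr hardy_of_poly; rewrite [in RHS]exprS; ring.
Qed.

Lemma genS k a b : pgen k.+1 a b = pgen k a.+1 b - pgen k a b.+1.
Proof.
rewrite /pgen -hardy_of_polyN -hardy_of_polyD; congr hardy_of_poly.
by rewrite !exprS; ring.
Qed.

Lemma gen0E a b i : pgen 0 a b i = (i == (a, b))%:R.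
Proof.
have mulzE f x j : (mulz f (0, j)%N = 0) * (mulz f (x.+1, j) = f (x, j)) by [].
have mulwE f x j : (mulw f (x, 0)%N = 0) * (mulw f (x, j.+1) = f (x, j)) by [].
elim: a b i => [|a IH] b; last first.
  by move=> [[|i] j]; rewrite -mulz_gen ?(mulzE _ 0%N) ?mulzE ?IH.
elim: b => [|b IH] [i [|j]]; rewrite -?mulw_gen ?(mulwE _ _ 0%N) ?mulwE ?IH //.
- by rewrite /= /poly_coef !expr0 !mul1r coef1/= coef1 xpair_eqE andbT.
- by rewrite /= /poly_coef !expr0 !mul1r coef1/= coef0 xpair_eqE andbF.
by rewrite xpair_eqE andbF.
Qed.

Lemma homogeneous_gen k a b : homogeneous (k + (a + b)) (pgen k a b).
Proof.
elim: k a b => [|k IH] a b.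
  by move=> i; rewrite gen0E; case: (i =P (a, b)) => [->|//]; rewrite add0n eqxx.
rewrite genS addSn -addnS; apply: homogeneousD; first by rewrite -addSn; exact: IH.
by rewrite -scaleN1r; apply: homogeneousZ; rewrite -addnS; exact: IH.
Qed.

(** On the unit circle |1 - t|^(2k) = (-1)^k t^(-k) (1 - t)^(2k), so this is the Fourier coefficient
    of index a - a' of that weight. The factor t^a' keeps the index k + a a natural number without
    subtraction. *)
Definition toeplitz k a a' : C :=
  (-1) ^+ k * ('X^a' * (1 - 'X) ^+ (2 * k) : {poly C})`_(k + a).

Lemma toeplitzSS k a a' : toeplitz k a.+1 a'.+1 = toeplitz k a a'.
Proof. by rewrite /toeplitz addnS exprS -mulrA coefXM. Qed.

Lemma toeplitzS k a a' :
  toeplitz k.+1 a a' = toeplitz k a a' *+ 2 - toeplitz k a.+1 a' - toeplitz k a a'.+1.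
Proof.
rewrite /toeplitz mulnS exprD; set r : {poly C} := _ ^+ (2 * k).
have -> : 'X^a' * ((1 - 'X) ^+ 2 * r) = 'X^a' * r - 'X * ('X^a' * r) *+ 2 +
    'X * ('X^(a'.+1) * r) by rewrite [in RHS]exprS; ring.
rewrite !coefD coefN coefMn coefXM coefXM /= addSn exprS addnS.
by rewrite mulr2n; ring.
Qed.

(** Induction on k: expanding one factor z - w on each side gives the four terms of [toeplitzS], two
    of which coincide. The start, k = 0, is the orthonormality of the monomials. *)
Lemma gram_z k a b a' b' : (a + b = a' + b')%N ->
  hardy_dot (pgen k a b) (pgen k a' b') = toeplitz k a a'.
Proof.
elim: k a b a' b' => [|k IH] a b a' b' ab.
  rewrite /hardy_dot (complex_sum_point (i0 := (a, b))).
    rewrite !gen0E eqxx mul1r conjC_nat /toeplitz expr0 mul1r muln0 expr0 mulr1 coefXn.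
    rewrite add0n xpair_eqE; congr (_%:R); congr nat_of_bool.
    by case: eqP => // aa'; apply/eqP; lia.
  by move=> i /negPf iab; rewrite !gen0E iab mul0r.
rewrite !genS dotBl !dotBr !IH ?toeplitzSS ?toeplitzS; try lia.
by rewrite mulr2n; ring.
Qed.

(** The Gram matrix is symmetric under exchanging z and w; this form serves the reversed
    polynomials, which are indexed by the power of w. *)
Lemma gram_w k a b a' b' : (a + b = a' + b')%N ->
  hardy_dot (pgen k a b) (pgen k a' b') = toeplitz k b b'.
Proof.
elim: k a b a' b' => [|k IH] a b a' b' ab.
  rewrite /hardy_dot (complex_sum_point (i0 := (a, b))).
    rewrite !gen0E eqxx mul1r conjC_nat /toeplitz expr0 mul1r muln0 expr0 mulr1 coefXn.
    rewrite add0n xpair_eqE; congr (_%:R); congr nat_of_bool.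
    by rewrite andbC; case: eqP => // bb'; apply/eqP; lia.
  by move=> i /negPf iab; rewrite !gen0E iab mul0r.
rewrite !genS dotBl !dotBr !IH ?toeplitzSS ?toeplitzS; try lia.
by rewrite mulr2n; ring.
Qed.

Lemma gen_total k f : (forall a b, hardy_dot f (pgen k a b) = 0) ->
  forall q, hardy_dot f (hardy_of_poly ((polyz - polyw) ^+ k * q)) = 0.
Proof.
move=> f0 q; suff H a b :
    hardy_dot f (hardy_of_poly ((polyz - polyw) ^+ k * (polyz ^+ a * (polyw ^+ b * q)))) = 0.
  by have := H 0%N 0%N; rewrite !expr0 !mul1r.
elim/poly_ind: q a b => [|q c IH] a b.
  by rewrite !mulr0 hardy_of_poly0 dot0r.
have -> : (polyz - polyw) ^+ k * (polyz ^+ a * (polyw ^+ b * (q * 'X + c%:P))) =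
   (polyz - polyw) ^+ k * (polyz ^+ a * (polyw ^+ b.+1 * q)) +
   (polyz - polyw) ^+ k * (polyz ^+ a * (polyw ^+ b * c%:P)).
  by rewrite exprS /polyw; ring.
rewrite hardy_of_polyD dotDr IH add0r.
elim/poly_ind: c a => [|c d IHc] a; first by rewrite !mulr0 hardy_of_poly0 dot0r.
have -> : (polyz - polyw) ^+ k * (polyz ^+ a * (polyw ^+ b * (c * 'X + d%:P)%:P)) =
   (polyz - polyw) ^+ k * (polyz ^+ a.+1 * (polyw ^+ b * c%:P)) +
   d%:P%:P * ((polyz - polyw) ^+ k * (polyz ^+ a * polyw ^+ b)).
  by rewrite exprS /polyz polyCD polyCM; ring.
by rewrite hardy_of_polyD dotDr IHc hardy_of_polyZ dotZr f0 mulr0 addr0.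
Qed.

End Generators.

(** * Orthogonality sums for the Szego coefficients *)

Section ToeplitzSums.
Variables (R : realType) (k' : nat).
Local Notation C := R[i].
Local Notation k := k'.+1.

Lemma sum_window (F : nat -> C) a n B : (a + n <= B)%N ->
    (forall x, F x != 0 -> (a <= x < a + n)%N) ->
  \sum_(x < B) F x = \sum_(j < n) F (a + j)%N.
Proof.
move=> anB F0; have F00 x : ~~ (a <= x < a + n)%N -> F x = 0.
  by move=> xan; apply/eqP; apply: contraNT xan => /F0.
rewrite -(big_mkord xpredT F) (big_cat_nat (n := a))//=; last first.
  by rewrite (leq_trans (leq_addr n a)).
rewrite big_nat_cond big1 ?add0r; last first.
  by move=> x; rewrite andbT => /andP[_ xa]; apply: F00; rewrite leqNgt xa.
rewrite (big_cat_nat (n := (a + n)%N))//= ?leq_addr// [X in _ + X]big_nat_cond.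
rewrite [X in _ + X]big1 ?addr0; last first.
  by move=> x; rewrite andbT => /andP[anx _]; apply: F00; rewrite andbC ltnNge anx.
rewrite -{1}(add0n a) big_addn addKn big_mkord.
by apply: eq_bigr => j _; rewrite addnC.
Qed.

(** As a polynomial in j this has degree 2k - 1 and vanishes for -k < j < 0 and for m < j <= m + k.
    A sum over 0 <= j <= m can thus be widened by almost k on the left and by k on the right, enough
    to become a full 2k-th difference. *)
Definition szego_coef (m j : nat) : nat := 'C(k' + j, k') * 'C(m + k - j, k).

Lemma coef_toeplitz_poly i x : ('X^i * (1 - 'X) ^+ (2 * k) : {poly C})`_x =
  if (i <= x)%N then (-1) ^+ (x - i) * 'C(2 * k, x - i)%:R else 0.
Proof.
rewrite coefXnM ltnNge; case: leqP => //= ix.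
have -> : (1 - 'X : {poly C}) = 1 + (-1) *: 'X by rewrite scaleN1r.
rewrite exprDn coef_sum.
have [xk|kx] := leqP (x - i) (2 * k); last first.
  rewrite bin_small// mulr0 big1// => j _.
  rewrite expr1n mul1r exprZn coefMn coefZ coefXn.
  case: eqP => [E|]; last by rewrite mulr0 mul0rn.
  by have := ltn_ord j; rewrite -E ltnNge kx.
rewrite (bigD1 (inord (x - i)))//= big1 ?addr0 => [|j jx].
  by rewrite inordK// expr1n mul1r exprZn coefMn coefZ coefXn eqxx mulr1 mulr_natr.
rewrite expr1n mul1r exprZn coefMn coefZ coefXn; case: eqP => [E|]; last by rewrite mulr0 mul0rn.
by case/eqP: jx; apply/val_inj; rewrite /= inordK.
Qed.

(** With x = k + j, both sides are the sum of W x * c x over all x: the left side runs over the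
    support of the coefficients W, the right side over that of the Toeplitz row c. *)
Lemma szego_sumE m i :
  \sum_(j < m.+1) (szego_coef m j)%:R * toeplitz R k j i =
  (-1) ^+ k * \sum_(l < (2 * k).+1) (-1) ^+ l * 'C(2 * k, l)%:R *
    (if (i + l)%N is x.+1 then ('C(x, k') * 'C(m + 2 * k - x.+1, k))%:R else 0).
Proof.
pose W x : C := if x is y.+1 then ('C(y, k') * 'C(m + 2 * k - x, k))%:R else 0.
pose c x : C := ('X^i * (1 - 'X) ^+ (2 * k) : {poly C})`_x.
have Wc x : W x * c x != 0 -> W x != 0 /\ c x != 0.
  by rewrite mulf_eq0 negb_or => /andP.
(* Any bound beyond the ends of both windows will do. *)
pose B := (k + m.+1 + (i + (2 * k).+1))%N.
transitivity ((-1) ^+ k * \sum_(x < B) W x * c x).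
  rewrite (@sum_window (fun x => W x * c x) k m.+1) ?leq_addr//; last first.
    move=> x /Wc[+ _]; case: x => [|x]; rewrite /W ?eqxx// pnatr_eq0 muln_eq0 negb_or.
    by rewrite -!lt0n !bin_gt0; lia.
  rewrite mulr_sumr; apply: eq_bigr => j _.
  rewrite /toeplitz mulrCA; congr (_ * (_ * _)).
  rewrite /W addSn /szego_coef.
  by congr ((_ * 'C(_, _))%:R); have := ltn_ord j; lia.
congr (_ * _); rewrite (@sum_window (fun x => W x * c x) i (2 * k).+1) ?leq_addl//; last first.
  move=> x /Wc[_]; rewrite /c coef_toeplitz_poly; have [ix|_] := leqP i x; last by rewrite eqxx.
  rewrite mulf_eq0 negb_or pnatr_eq0 -lt0n bin_gt0 => /andP[_]; lia.
apply: eq_bigr => l _; rewrite mulrC /c coef_toeplitz_poly leq_addr addKn.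
by congr (_ * _); rewrite /W; case: (i + l)%N.
Qed.

(** Here 1 <= i + l <= m + 2k throughout, so every term agrees with the polynomial of degree 2k - 1
    and the 2k-th difference vanishes. *)
Lemma szego_sum_mid m i : (0 < i <= m)%N ->
  \sum_(j < m.+1) (szego_coef m j)%:R * toeplitz R k j i = 0.
Proof.
case: i => // i im; rewrite szego_sumE.
have := @bin_diff_eq0 C (2 * k) k' k i (m + 2 * k - i.+1) _ _.
rewrite /bin_diff => E; rewrite (eq_bigr (fun l : 'I__ =>
   (-1) ^+ l * ('C(2 * k, l) * ('C(i + l, k') * 'C(m + 2 * k - i.+1 - l, k)))%:R)).
  by rewrite E ?mulr0//; lia.
move=> l _; rewrite addSn [in RHS]natrM mulrA; congr (_ * (_ * 'C(_, _))%:R); lia.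
Qed.

(** Only the term l = 0 differs from the polynomial: it is 0 in the sum, whereas the polynomial C(l
    - 1, k') equals (-1)^k' there. *)
Lemma szego_sum0 m :
  \sum_(j < m.+1) (szego_coef m j)%:R * toeplitz R k j 0 = 'C(m + 2 * k, k)%:R.
Proof.
rewrite szego_sumE big_ord_recl /= mulr0 add0r.
have := @bin_diff_pred C (2 * k) k' k (m + 2 * k) _ _ => E.
rewrite (eq_bigr (fun l : 'I__ => (-1) ^+ l.+1 *
   ('C(2 * k, l.+1) * ('C(l, k') * 'C(m + 2 * k - l.+1, k)))%:R)).
  by rewrite E; [rewrite mulrA -expr2 sqrr_sign mul1r|lia..].
by move=> l _; rewrite [in RHS]natrM mulrA.
Qed.

(** Now the last term, l = 2k, is the exception: the truncated subtraction gives C(0, k) = 0 in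
    place of the polynomial value C(-1, k) = (-1)^k. *)
Lemma szego_sum_last m :
  \sum_(j < m.+1) (szego_coef m j)%:R * toeplitz R k j m.+1 = - 'C(m + 2 * k, k')%:R.
Proof.
rewrite szego_sumE big_ord_recr /=.
have -> : (m + 2 * k - (m + 2 * k).+1 = 0)%N by lia.
rewrite bin0n muln0 mulr0 addr0.
have := @bin_diff_last C (2 * k) k' k m _ => E.
rewrite (eq_bigr (fun l : 'I__ => (-1) ^+ l *
   ('C(2 * k, l) * ('C(m + l, k') * 'C(2 * k - l.+1, k)))%:R)).
  rewrite E; last lia.
  rewrite mulrA -exprD (_ : (k + _)%N = (2 * (2 * k)).+1); last lia.
  by rewrite exprS exprM sqrrN !expr1n mulr1 mulN1r.
move=> l _; rewrite [in RHS]natrM mulrA; congr (_ * (_ * 'C(_, _))%:R); lia.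
Qed.

End ToeplitzSums.

(** * Action of the core operator on the generators *)

Section Submodule.
Variables (R : realType) (k' : nat).
Implicit Types (f g h : hardy R).
Local Notation C := R[i].
Local Notation k := k'.+1.

Local Notation A := [set hardy_of_poly ((polyz R - polyw R) ^+ k * q) |
  q in [set: {poly {poly R[i]}}]].
Local Notation M := (closure A).
Local Notation T := (core_operator M).
Local Notation gen := (@pgen R k).

(** The truncated length [N.+1 - k] makes the list empty below degree k, the least degree in M. *)
Definition gens_of_degree (N : nat) : seq (hardy R) :=
  [seq gen a (N - k - a) | a <- iota 0 (N.+1 - k)].

Lemma mem_gens a b : gen a b \in gens_of_degree (k + (a + b)).
Proof.
by apply/mapP; exists a; [rewrite mem_iota; lia|congr (pgen _ _ _); lia].
Qed.

Lemma gens_of_degreeP N f : f \in gens_of_degree N ->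
  exists a b, (k + (a + b))%N = N /\ f = gen a b.
Proof.
by case/mapP=> a; rewrite mem_iota => aN ->; exists a, (N - k - a)%N; split => //; lia.
Qed.

Lemma multiples_graded : graded_submodule A gens_of_degree.
Proof.
split.
- split=> [|c _ _ [q _ <-] [q' _ <-]]; first by exists 0; rewrite ?mulr0 ?hardy_of_poly0.
  exists (c%:P%:P * q + q') => //.
  by rewrite mulrDr hardy_of_polyD mulrCA hardy_of_polyZ.
- by move=> N _ /gens_of_degreeP[a [b [_ ->]]]; exists (polyz R ^+ a * polyw R ^+ b).
- by move=> N _ /gens_of_degreeP[a [b [<- ->]]]; exact: homogeneous_gen.
- move=> f f0 _ [q _ <-]; apply: gen_total => a b.
  exact: f0 (mem_gens a b).
- move=> _ [q _ <-]; exists (polyz R * q) => //.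
  by rewrite mulz_hardy_of_poly mulrCA.
- move=> _ [q _ <-]; exists (polyw R * q) => //.
  by rewrite mulw_hardy_of_poly mulrCA.
Qed.

Local Notation hA := multiples_graded.

Local Opaque core_operator orth_proj hardy_dot mulz mulw backz backw pgen.

Lemma gen_mem a b : M (gen a b).
Proof. by apply: subset_closure; apply: (gens_mem hA (mem_gens a b)). Qed.

Lemma orth_gen f : (forall a b, hardy_dot f (gen a b) = 0) ->
  forall h, M h -> hardy_dot f h = 0.
Proof.
move=> f0; apply: (gens_orth hA) => N _ /gens_of_degreeP[a [b [_ ->]]].
exact: f0.
Qed.

Lemma eq_gen f g : M f -> M g ->
  (forall a b, hardy_dot f (gen a b) = hardy_dot g (gen a b)) -> f = g.
Proof.
move=> Mf Mg fg; apply: (gens_eq hA) => // N _ /gens_of_degreeP[a [b [_ ->]]].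
exact: fg.
Qed.

Lemma orth_proj_gen f m : M m ->
  (forall a b, hardy_dot f (gen a b) = hardy_dot m (gen a b)) -> orth_proj M f = m.
Proof.
move=> Mm fm; apply: (orth_proj_eq hA) => // h Mh; apply/eqP.
rewrite -subr_eq0 -dotBl; apply/eqP; apply: orth_gen => // a b.
by rewrite dotBl fm subrr.
Qed.

Lemma orth_proj_gen0 f : (forall a b, hardy_dot f (gen a b) = 0) -> orth_proj M f = 0.
Proof.
move=> f0; apply: orth_proj_gen => [|a b]; last by rewrite f0 dot0l.
by case: (lin_subspace_closure (graded_lin_subspace hA)).
Qed.

(** Since (z - w)^k has the least degree in M, its backward shifts are orthogonal to M and only the
    first term of the core operator survives. *)
Lemma core_gen00 : T (gen 0 0) = gen 0 0.
Proof.
have orthz : orth_proj M (backz (gen 0 0)) = 0.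
  apply: orth_proj_gen0 => a b; rewrite -dot_mulzr mulz_gen.
  by apply: (dot_homogeneous _ (@homogeneous_gen _ _ _ _) (@homogeneous_gen _ _ _ _)); lia.
have orthw : orth_proj M (backw (gen 0 0)) = 0.
  apply: orth_proj_gen0 => a b; rewrite -dot_mulwr mulw_gen.
  by apply: (dot_homogeneous _ (@homogeneous_gen _ _ _ _) (@homogeneous_gen _ _ _ _)); lia.
have orthzw : orth_proj M (backz (backw (gen 0 0))) = 0.
  apply: orth_proj_gen0 => a b; rewrite -dot_mulzr -dot_mulwr mulz_gen mulw_gen.
  by apply: (dot_homogeneous _ (@homogeneous_gen _ _ _ _) (@homogeneous_gen _ _ _ _)); lia.
rewrite (core_operatorE hA) orthz orthw orthzw !linear0 !addr0.
exact: (orth_proj_id hA (@gen_mem _ _)).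
Qed.

(** On zwM no projection changes anything, so the four terms are zwg with signs +, -, -, + and
    cancel. *)
Lemma core_mulzw g : M g -> T (mulz (mulw g)) = 0.
Proof.
move=> Mg; have Mw := @closure_mulw _ _ _ hA _ Mg; have Mz := @closure_mulz _ _ _ hA _ Mg.
have E1 : backw (mulz (mulw g)) = mulz g by rewrite backw_mulz hardy_mulwK.
rewrite (core_operatorE hA) hardy_mulzK E1 hardy_mulzK.
rewrite (orth_proj_id hA Mw) (orth_proj_id hA Mz) (orth_proj_id hA Mg).
rewrite (orth_proj_id hA (@closure_mulz _ _ _ hA _ Mw)).
by rewrite subrr sub0r mulzw addNr.
Qed.

Lemma core_gen a b : T (gen a.+1 b.+1) = 0.
Proof. by rewrite -mulz_gen -mulw_gen; apply: core_mulzw; exact: gen_mem. Qed.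

(* The orthogonal polynomials of the weight |1 - t|^(2k) on the unit circle and
   their reversals, made homogeneous and multiplied by (z - w)^k:
   [szego m] spans the complement of zM in degree k + m, [szego_rev m] that of
   wM. *)
Definition szego m : hardy R :=
  \sum_(j < m.+1) (szego_coef k' m j)%:R *: gen j (m - j).

Definition szego_rev m : hardy R :=
  \sum_(j < m.+1) (szego_coef k' m j)%:R *: gen (m - j) j.

Definition szego_dot m i : C :=
  \sum_(j < m.+1) (szego_coef k' m j)%:R * toeplitz R k j i.

Definition lambda m : C := k%:R / (m.+1 + k)%:R.

Lemma szego_mem m : M (szego m).
Proof.
have S := lin_subspace_closure (graded_lin_subspace hA).
apply: (lin_subspace_sum S) => j; apply: (lin_subspaceZ _ S); exact: gen_mem.
Qed.

Lemma szego_rev_mem m : M (szego_rev m).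
Proof.
have S := lin_subspace_closure (graded_lin_subspace hA).
apply: (lin_subspace_sum S) => j; apply: (lin_subspaceZ _ S); exact: gen_mem.
Qed.

Lemma homogeneous_sum N n (F : 'I_n -> hardy R) :
  (forall j, homogeneous N (F j)) -> homogeneous N (\sum_(j < n) F j).
Proof. by move=> FN i iN; rewrite hardy_sumE big1// => j _; exact: FN. Qed.

Lemma homogeneous_szego m : homogeneous (k + m) (szego m).
Proof.
apply: homogeneous_sum => j; apply: homogeneousZ.
have -> : (k + m = k + (j + (m - j)))%N by have := ltn_ord j; lia.
exact: homogeneous_gen.
Qed.

Lemma homogeneous_szego_rev m : homogeneous (k + m) (szego_rev m).
Proof.
apply: homogeneous_sum => j; apply: homogeneousZ.
have -> : (k + m = k + ((m - j) + j))%N by have := ltn_ord j; lia.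
exact: homogeneous_gen.
Qed.

Lemma dot_szego m a b : (a + b = m)%N ->
  hardy_dot (szego m) (gen a b) = szego_dot m a.
Proof.
move=> abm; rewrite dot_suml; apply: eq_bigr => j _; rewrite dotZl gram_z//.
by have := ltn_ord j; lia.
Qed.

Lemma dot_szego_rev m a b : (a + b = m)%N ->
  hardy_dot (szego_rev m) (gen a b) = szego_dot m b.
Proof.
move=> abm; rewrite dot_suml; apply: eq_bigr => j _; rewrite dotZl gram_w//.
by have := ltn_ord j; lia.
Qed.

Lemma mulw_szego m :
  mulw (szego m) = \sum_(j < m.+1) (szego_coef k' m j)%:R *: gen j (m.+1 - j).
Proof.
rewrite linear_sum; apply: eq_bigr => j _; rewrite linearZ/= mulw_gen subSn//.
by rewrite -ltnS.
Qed.

Lemma mulz_szego_rev m :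
  mulz (szego_rev m) = \sum_(j < m.+1) (szego_coef k' m j)%:R *: gen (m.+1 - j) j.
Proof.
rewrite linear_sum; apply: eq_bigr => j _; rewrite linearZ/= mulz_gen subSn//.
by rewrite -ltnS.
Qed.

Lemma dot_mulw_szego m a b : (a + b = m.+1)%N ->
  hardy_dot (mulw (szego m)) (gen a b) = szego_dot m a.
Proof.
move=> abm; rewrite mulw_szego dot_suml; apply: eq_bigr => j _; rewrite dotZl gram_z//.
by have := ltn_ord j; lia.
Qed.

Lemma dot_mulz_szego_rev m a b : (a + b = m.+1)%N ->
  hardy_dot (mulz (szego_rev m)) (gen a b) = szego_dot m b.
Proof.
move=> abm; rewrite mulz_szego_rev dot_suml; apply: eq_bigr => j _; rewrite dotZl gram_w//.
by have := ltn_ord j; lia.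
Qed.

Lemma szego_dot_mid m i : (0 < i <= m)%N -> szego_dot m i = 0.
Proof. exact: szego_sum_mid. Qed.

Lemma szego_dot0_neq0 m : szego_dot m 0 != 0.
Proof. by rewrite /szego_dot szego_sum0 pnatr_eq0 -lt0n bin_gt0; lia. Qed.

(** The two boundary sums are binomials of m + 2k with consecutive lower indices k - 1 and k; their
    ratio k / (m + 1 + k) is the source of the eigenvalues. *)
Lemma szego_dot_last m : szego_dot m m.+1 = - lambda m * szego_dot m 0.
Proof.
rewrite /szego_dot szego_sum_last szego_sum0 mulNr; congr (- _).
have := mul_bin_left (m + 2 * k) k'.
have -> : (m + 2 * k - k' = m.+1 + k)%N by lia.
by move=> E; rewrite /lambda mulrAC -natrM E natrM mulrAC mulfV ?mul1r.
Qed.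

(** Among the generators of degree k + m, both sides pair to 0 with all but [gen 0 m]; on that one
    the factor is given by [szego_dot_last]. *)
Lemma orth_proj_backw_mulz_szego_rev m :
  orth_proj M (backw (mulz (szego_rev m))) = - lambda m *: szego m.
Proof.
have S := lin_subspace_closure (graded_lin_subspace hA).
apply: orth_proj_gen => [|a b]; first by apply: (lin_subspaceZ _ S); exact: szego_mem.
rewrite -dot_mulwr mulw_gen dotZl.
have [abm|abm] := eqVneq (a + b)%N m.
  rewrite dot_mulz_szego_rev ?dot_szego ?addnS ?abm//.
  case: a abm => [|a] abm; first by rewrite -abm add0n szego_dot_last.
  by rewrite !szego_dot_mid ?mulr0//; lia.
rewrite (dot_homogeneous _ (@homogeneous_mulz _ _ _ (@homogeneous_szego_rev m)) (@homogeneous_gen _ _ _ _)).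
  rewrite (dot_homogeneous _ (@homogeneous_szego m) (@homogeneous_gen _ _ _ _)) ?mulr0//.
  by apply: contra abm => /eqP; lia.
by apply: contra abm => /eqP; lia.
Qed.

Lemma orth_proj_backz_mulw_szego m :
  orth_proj M (backz (mulw (szego m))) = - lambda m *: szego_rev m.
Proof.
have S := lin_subspace_closure (graded_lin_subspace hA).
apply: orth_proj_gen => [|a b]; first by apply: (lin_subspaceZ _ S); exact: szego_rev_mem.
rewrite -dot_mulzr mulz_gen dotZl.
have [abm|abm] := eqVneq (a + b)%N m.
  rewrite dot_mulw_szego ?dot_szego_rev ?addSn ?abm//.
  case: b abm => [|b] abm; first by rewrite -abm addn0 szego_dot_last.
  by rewrite !szego_dot_mid ?mulr0//; lia.
rewrite (dot_homogeneous _ (@homogeneous_mulw _ _ _ (@homogeneous_szego m)) (@homogeneous_gen _ _ _ _)).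
  rewrite (dot_homogeneous _ (@homogeneous_szego_rev m) (@homogeneous_gen _ _ _ _)) ?mulr0//.
  by apply: contra abm => /eqP; lia.
by apply: contra abm => /eqP; lia.
Qed.

Lemma orth_proj_backw_szego_rev m : orth_proj M (backw (szego_rev m)) = 0.
Proof.
apply: orth_proj_gen0 => a b; rewrite -dot_mulwr mulw_gen.
have [abm|abm] := eqVneq (a + b.+1)%N m.
  by rewrite dot_szego_rev// szego_dot_mid//; lia.
apply: (dot_homogeneous _ (@homogeneous_szego_rev m) (@homogeneous_gen _ _ _ _)).
by apply: contra abm => /eqP; lia.
Qed.

Lemma orth_proj_backz_szego m : orth_proj M (backz (szego m)) = 0.
Proof.
apply: orth_proj_gen0 => a b; rewrite -dot_mulzr mulz_gen.
have [abm|abm] := eqVneq (a.+1 + b)%N m.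
  by rewrite dot_szego// szego_dot_mid//; lia.
apply: (dot_homogeneous _ (@homogeneous_szego m) (@homogeneous_gen _ _ _ _)).
by apply: contra abm => /eqP; lia.
Qed.

(** The first two terms of the core operator cancel because zM is contained in M, and the last
    vanishes because [szego_rev] is orthogonal to wM; only the cross term in w remains. *)
Lemma core_mulz_szego_rev m : T (mulz (szego_rev m)) = lambda m *: mulw (szego m).
Proof.
have Me := @szego_rev_mem m.
rewrite (core_operatorE hA) orth_proj_backw_mulz_szego_rev backzw hardy_mulzK.
rewrite orth_proj_backw_szego_rev (orth_proj_id hA Me) (orth_proj_id hA (@closure_mulz _ _ _ hA _ Me)).
by rewrite !linear0 addr0 subrr sub0r linearZ/= scaleNr opprK.
Qed.

Lemma core_mulw_szego m : T (mulw (szego m)) = lambda m *: mulz (szego_rev m).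
Proof.
have Me := @szego_mem m.
rewrite (core_operatorE hA) orth_proj_backz_mulw_szego hardy_mulwK.
rewrite orth_proj_backz_szego (orth_proj_id hA Me) (orth_proj_id hA (@closure_mulw _ _ _ hA _ Me)).
by rewrite !linear0 addr0 addrAC subrr sub0r linearZ/= scaleNr opprK.
Qed.

Lemma coreD f g : T (f + g) = T f + T g.
Proof. by have := core_operator_is_linear hA 1 f g; rewrite !scale1r. Qed.

Lemma core0 : T 0 = 0.
Proof. by apply: (addrI (T 0)); rewrite -coreD !addr0. Qed.

Lemma coreZ c f : T (c *: f) = c *: T f.
Proof. by have := core_operator_is_linear hA c f 0; rewrite core0 !addr0. Qed.

Lemma core_sum n (F : 'I_n -> hardy R) : T (\sum_(j < n) F j) = \sum_(j < n) T (F j).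
Proof.
apply: (big_morph T) => [f g|]; first exact: coreD.
exact: core0.
Qed.

(** Modulo zwM, which T kills, [mulz (szego_rev m)] is a nonzero multiple of [gen m.+1 0]. *)
Lemma core_gen_z m : T (gen m.+1 0) =
  ((szego_coef k' m 0)%:R^-1 * lambda m) *: mulw (szego m).
Proof.
have q0 : (szego_coef k' m 0)%:R != 0 :> C.
  by rewrite pnatr_eq0 /szego_coef muln_eq0 negb_or -!lt0n !bin_gt0; lia.
have := core_mulz_szego_rev m; rewrite mulz_szego_rev core_sum big_ord_recl big1 => [|j _].
  rewrite addr0 coreZ subn0 => /(congr1 (fun x => (szego_coef k' m 0)%:R^-1 *: x)).
  by rewrite !scalerA mulVf// scale1r.
rewrite coreZ (_ : (m.+1 - lift ord0 j = (m - j.+1).+1)%N) ?core_gen ?scaler0//.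
by rewrite lift0 subnSK.
Qed.

Lemma core_gen_w m : T (gen 0 m.+1) =
  ((szego_coef k' m 0)%:R^-1 * lambda m) *: mulz (szego_rev m).
Proof.
have q0 : (szego_coef k' m 0)%:R != 0 :> C.
  by rewrite pnatr_eq0 /szego_coef muln_eq0 negb_or -!lt0n !bin_gt0; lia.
have := core_mulw_szego m; rewrite mulw_szego core_sum big_ord_recl big1 => [|j _].
  rewrite addr0 coreZ subn0 => /(congr1 (fun x => (szego_coef k' m 0)%:R^-1 *: x)).
  by rewrite !scalerA mulVf// scale1r.
rewrite coreZ (_ : (m.+1 - lift ord0 j = (m - j.+1).+1)%N) ?core_gen ?scaler0//.
by rewrite lift0 subnSK.
Qed.

Lemma homogeneous_core_gen a b : homogeneous (k + (a + b)) (T (gen a b)).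
Proof.
case: a b => [|a] [|b].
- by rewrite core_gen00; exact: homogeneous_gen.
- rewrite core_gen_w add0n addnS; apply: homogeneousZ.
  by apply: homogeneous_mulz; exact: homogeneous_szego_rev.
- rewrite core_gen_z addn0 addnS; apply: homogeneousZ.
  by apply: homogeneous_mulw; exact: homogeneous_szego.
- by move=> i _; rewrite core_gen hardy0E.
Qed.

Definition core_ratio (N : nat) : C := k%:R / N%:R.

Lemma lambdaE m : lambda m = core_ratio (k + m.+1).
Proof. by rewrite /lambda addnC. Qed.

Lemma core_cube_gen a b :
  T (T (T (gen a b))) = (core_ratio (k + (a + b)) ^+ 2) *: T (gen a b).
Proof.
case: a b => [|a] [|b].
- by rewrite !core_gen00 /core_ratio !addn0 mulfV ?expr1n ?scale1r// pnatr_eq0.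
- rewrite add0n !core_gen_w -lambdaE !coreZ core_mulz_szego_rev coreZ core_mulw_szego.
  by rewrite !scalerA; congr (_ *: _); ring.
- rewrite addn0 !core_gen_z -lambdaE !coreZ core_mulw_szego coreZ core_mulz_szego_rev.
  by rewrite !scalerA; congr (_ *: _); ring.
- by rewrite core_gen !core0 scaler0.
Qed.

End Submodule.

(** * The spectrum *)

Section Spectral.
Variables (R : realType) (k' : nat).
Implicit Types (f g h : hardy R) (s : nat -> R[i]).
Local Notation C := R[i].
Local Notation k := k'.+1.
Local Notation M := (closure [set hardy_of_poly ((polyz R - polyw R) ^+ k * q) |
  q in [set: {poly {poly R[i]}}]]).
Local Notation T := (core_operator M).
Local Notation gen := (@pgen R k).
Local Notation hA := (multiples_graded R k').
Local Notation core_ratio := (core_ratio R k').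
Local Notation lambda := (lambda R k').

Local Opaque core_operator orth_proj hardy_dot mulz mulw backz backw pgen.

Lemma core_mem f : M (T f).
Proof. exact: (core_operator_mem hA). Qed.

Lemma core_selfadjoint f g : hardy_dot (T f) g = hardy_dot f (T g).
Proof. exact: (core_operator_selfadjoint hA). Qed.

(** The part x of [graded sb f] orthogonal to M satisfies <x, x> = <x, graded f>. Moving the
    operator to x only rescales the pairings of x with the homogeneous generators, which are 0. *)
Lemma graded_mem s (sb : bounded_coefs s) f : M f -> M (graded sb f).
Proof.
move=> Mf; pose x := graded sb f - orth_proj M (graded sb f).
have Px := @orth_proj_mem _ _ _ hA (graded sb f).
have xM h : M h -> hardy_dot x h = 0.
  by move=> Mh; rewrite dotBl (dot_orth_projl hA _ Mh) subrr.
have : hardy_dot x x = 0.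
  rewrite {2}/x dotBr (xM _ Px) subr0 dotC dot_graded -dotC.
  apply: (@orth_gen _ k' _ _ f Mf) => a b.
  rewrite (dot_graded_homogeneous _ _ (@homogeneous_gen _ _ _ _)).
  by rewrite xM ?mulr0//; exact: gen_mem.
by move=> /dot_self_eq0/eqP; rewrite subr_eq0 => /eqP ->.
Qed.

(** Tested on generators: T maps each one to a homogeneous element of the same degree, so both sides
    acquire the same factor. *)
Lemma core_graded s (sb : bounded_coefs s) f : T (graded sb f) = graded sb (T f).
Proof.
apply: eq_gen => [||a b]; [exact: core_mem|exact/graded_mem/core_mem|].
rewrite (dot_graded_homogeneous _ _ (@homogeneous_gen _ _ _ _)).
rewrite [LHS]core_selfadjoint [in RHS]core_selfadjoint.
by rewrite (dot_graded_homogeneous _ _ (@homogeneous_core_gen _ _ _ _)).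
Qed.

Lemma component_gen_eq N f g : M f -> M g ->
    (forall a b, (k + (a + b) = N)%N ->
       hardy_dot f (gen a b) = hardy_dot g (gen a b)) ->
  component N f = component N g.
Proof.
move=> Mf Mg fg; apply: eq_gen => [||a b]; [exact: graded_mem..|].
rewrite !(dot_graded_homogeneous _ _ (@homogeneous_gen _ _ _ _)).
have [/fg ->//|abN] := eqVneq (k + (a + b))%N N.
by rewrite /= (negPf abN) !mul0r.
Qed.

Lemma component_eqE N f g i : component N f = component N g ->
  (i.1 + i.2 = N)%N -> f i = g i.
Proof.
move=> /(congr1 (fun h : hardy R => h i)) + iN.
by rewrite !componentE iN eqxx.
Qed.

Lemma core_low f i : (i.1 + i.2 < k)%N -> T f i = 0.
Proof.
move=> ik; rewrite -[RHS]/((0 : hardy R) i).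
apply: (@component_eqE (i.1 + i.2)%N) => //; apply: component_gen_eq.
- exact: core_mem.
- by case: (lin_subspace_closure (graded_lin_subspace hA)).
- by move=> a b abi; move: ik; rewrite -abi ltnNge leq_addr.
Qed.

Lemma core_idem f i : (i.1 + i.2)%N = k -> T (T f) i = T f i.
Proof.
move=> ik; apply: (component_eqE _ ik); apply: component_gen_eq; [exact: core_mem..|].
move=> a b abk; have [-> ->] : a = 0%N /\ b = 0%N by lia.
by rewrite [LHS]core_selfadjoint core_gen00.
Qed.

Lemma core_cube f i : (k <= i.1 + i.2)%N ->
  T (T (T f)) i = core_ratio (i.1 + i.2) ^+ 2 * T f i.
Proof.
move=> ki; rewrite -hardyZE.
have S := lin_subspace_closure (graded_lin_subspace hA).
apply: (@component_eqE (i.1 + i.2)%N) => //; apply: component_gen_eq.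
- exact: core_mem.
- by apply: (lin_subspaceZ _ S); exact: core_mem.
move=> a b <-; rewrite [in RHS]dotZl [in RHS]core_selfadjoint.
do 3! rewrite [LHS]core_selfadjoint.
rewrite core_cube_gen [LHS]dotZr.
(* The factor came out of the second argument conjugated, and [core_ratio] is real. *)
congr (_ * _); rewrite rmorphXn/=; congr (_ ^+ 2).
by rewrite /core_ratio rmorphM/= fmorphV/= !rmorph_nat.
Qed.

Lemma gen00_neq0 : gen 0 0 != 0.
Proof.
apply/eqP => g0; have := szego_dot0_neq0 R k' 0.
by rewrite -(@dot_szego _ _ 0 0 0)// g0 dot0r eqxx.
Qed.

Lemma lambda_neq1 m : lambda m != 1.
Proof.
have n0 : (m.+1 + k)%:R != 0 :> C by rewrite pnatr_eq0.
rewrite /lambda -subr_eq0 -[X in _ - X](divff n0) -mulrBl mulf_eq0 invr_eq0 negb_or n0 andbT.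
by rewrite subr_eq0 eqr_nat; apply/eqP; lia.
Qed.

Lemma lambda_neqN1 m : lambda m != -1.
Proof.
have n0 : (m.+1 + k)%:R != 0 :> C by rewrite pnatr_eq0.
rewrite /lambda -subr_eq0 opprK -[X in _ + X](divff n0) -mulrDl mulf_eq0 invr_eq0 negb_or n0 andbT.
by rewrite -natrD pnatr_eq0.
Qed.

Lemma core_eigenvector (c : C) m : c ^+ 2 = 1 ->
  exists2 x, x != 0 & T x = (c * lambda m) *: x.
Proof.
move=> c2; exists (mulz (szego_rev R k' m) + c *: mulw (szego R k' m)).
  apply/eqP => x0.
  (* This pairing equals (1 - c lambda) times the nonzero [szego_dot m 0]; as c is 1 or -1, its
     vanishing would force lambda to be 1 or -1. *)
  have : hardy_dot (mulz (szego_rev R k' m) + c *: mulw (szego R k' m)) (gen m.+1 0) = 0.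
    by rewrite x0 dot0l.
  rewrite dotDl dotZl dot_mulz_szego_rev ?addn0// dot_mulw_szego ?addn0//.
  rewrite szego_dot_last mulNr mulrN mulrA -{1}[szego_dot _ _ _ _]mul1r -mulrBl.
  move/eqP; rewrite mulf_eq0 (negPf (szego_dot0_neq0 _ _ _)) orbF subr_eq0.
  move=> /eqP cl; have : lambda m = c.
    by rewrite -[LHS]mul1r -c2 expr2 -mulrA -cl mulr1.
  move: c2 => /eqP; rewrite sqrf_eq1 => /orP[]/eqP -> /eqP.
    by rewrite (negPf (lambda_neq1 _)).
  by rewrite (negPf (lambda_neqN1 _)).
rewrite coreD coreZ core_mulz_szego_rev core_mulw_szego scalerDr !scalerA addrC.
by congr (_ *: _ + _ *: _); rewrite mulrAC -expr2 c2 mul1r.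
Qed.

(** The sum of the z^a w^(N - a), that is (z^(N+1) - w^(N+1)) / (z - w). Pairing f with it gives the
    coefficient of t^N in f(t, t); these vectors lie in the orthogonal complement of M and make the
    kernel infinite-dimensional. *)
Definition complete_sym (N : nat) : hardy R := \sum_(a < N.+1) pgen R 0 a (N - a).

Lemma complete_symE N i : complete_sym N i = (i.1 + i.2 == N)%N%:R.
Proof.
rewrite hardy_sumE; under eq_bigr do rewrite gen0E.
case: eqP => [iN|iN]; last first.
  rewrite big1// => j _; case: eqP => // ij; case: iN; rewrite ij/= subnKC//.
  by rewrite -ltnS.
have iN1 : (i.1 < N.+1)%N by lia.
rewrite (bigD1 (Ordinal iN1))//= big1 ?addr0 => [|j ji].
  by case: eqP => //; case: (i) iN => x y /= <- []; rewrite addKn.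
case: eqP => // ij; case/eqP: ji; apply/val_inj => /=.
by rewrite ij.
Qed.

(* The elements of M vanish on the diagonal z = w. *)
Lemma complete_sym_orth N a b : hardy_dot (complete_sym N) (gen a b) = 0.
Proof.
rewrite genS -mulz_gen -mulw_gen dotBr dot_mulzr dot_mulwr -dotBl.
suff -> : backz (complete_sym N) = backw (complete_sym N) by rewrite subrr dot0l.
apply: hardyP => i.
rewrite -[LHS]/(complete_sym N (i.1.+1, i.2)) -[RHS]/(complete_sym N (i.1, i.2.+1)).
by rewrite !complete_symE /= addSnnS.
Qed.

Lemma core_complete_sym N : T (complete_sym N) = 0.
Proof.
apply: eq_gen => [||a b]; first exact: core_mem.
  by case: (lin_subspace_closure (graded_lin_subspace hA)).
rewrite core_selfadjoint dot0l; apply: (@orth_gen _ k') => [x y|].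
  exact: complete_sym_orth.
exact: core_mem.
Qed.

Lemma complete_sym_independent n (c : 'I_n -> C) :
  \sum_(i < n) c i *: complete_sym i = 0 -> forall i, c i = 0.
Proof.
move=> c0 j; have := congr1 (fun h : hardy R => h (nat_of_ord j, 0%N)) c0.
rewrite hardy_sumE hardy0E (bigD1 j)// big1 ?addr0 => [|i /andP[_ ij]].
  by rewrite hardyZE complete_symE /= addn0 eqxx mulr1 addr0.
by rewrite hardyZE complete_symE /= addn0 (inj_eq val_inj) eq_sym (negPf ij) mulr0.
Qed.

(** The relations for T hold coefficientwise, so a single nonzero coefficient of x can be divided
    out, leaving an equation for l alone. *)
Lemma core_eigenvalue l x i : l != 0 -> T x = l *: x -> x i != 0 ->
  (k <= i.1 + i.2)%N /\ l ^+ 2 = core_ratio (i.1 + i.2) ^+ 2 /\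
  ((i.1 + i.2)%N = k -> l = 1).
Proof.
move=> l0 Tx xi.
have ki : (k <= i.1 + i.2)%N.
  rewrite leqNgt; apply/negP => /(core_low x)/eqP.
  by rewrite Tx hardyZE mulf_eq0 (negPf l0) (negPf xi).
split=> //; split=> [|ik].
  have := core_cube x ki; rewrite !(Tx, coreZ) !scalerA !hardyZE.
  rewrite mulrA => /(mulIf xi) E; apply: (mulIf l0).
  by rewrite -E expr2.
have := core_idem x ik; rewrite !(Tx, coreZ) !scalerA !hardyZE => /(mulIf xi).
by move=> E; apply: (mulIf l0); rewrite mul1r.
Qed.

Lemma ratio_sqr_eq1 N : (k <= N)%N -> core_ratio N ^+ 2 = 1 -> N = k.
Proof.
move=> kN; have N0 : N%:R != 0 :> C by rewrite pnatr_eq0 -lt0n (leq_trans _ kN).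
rewrite /core_ratio expr_div_n => /(congr1 ( *%R^~ (N%:R ^+ 2))).
rewrite divfK ?expf_neq0// mul1r -!natrX => /eqP; rewrite eqr_nat eqn_exp2r//.
by move/eqP.
Qed.

(** The ratio k/N has square 1 only for N = k, so x is homogeneous of degree k, where M has the
    single generator (z - w)^k. *)
Lemma core_eigenspace1 x : T x = x -> exists c, x = c *: gen 0 0.
Proof.
move=> Tx; have hx : homogeneous k x.
  move=> i ik; apply/eqP; apply: contraNT ik => xi.
  have Tx1 : T x = 1 *: x by rewrite scale1r.
  have [ki [E _]] := core_eigenvalue (oner_neq0 _) Tx1 xi.
  by apply/eqP/ratio_sqr_eq1; rewrite // -E expr1n.
have S := lin_subspace_closure (graded_lin_subspace hA).
exists (hardy_dot x (gen 0 0) / hardy_dot (gen 0 0) (gen 0 0)).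
apply: eq_gen => [||a b]; first by rewrite -Tx; exact: core_mem.
  by apply: (lin_subspaceZ _ S); exact: gen_mem.
have g0 : hardy_dot (gen 0 0) (gen 0 0) != 0.
  by apply: contraNneq gen00_neq0 => /dot_self_eq0 ->.
rewrite dotZl; have [ab0|ab0] := eqVneq (a + b)%N 0%N.
  have [-> ->] : a = 0%N /\ b = 0%N by lia.
  by rewrite divfK.
have -> : hardy_dot (gen 0 0) (gen a b) = 0.
  apply: (dot_homogeneous _ (@homogeneous_gen _ _ _ _) (@homogeneous_gen _ _ _ _)).
  by apply: contra ab0 => /eqP; lia.
rewrite mulr0; apply: (dot_homogeneous _ hx (@homogeneous_gen _ _ _ _)).
by apply: contra ab0 => /eqP; lia.
Qed.

End Spectral.

(** * A bounded inverse of T - l away from the eigenvalues *)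

Section Resolvent.
Variables (R : realType) (k' : nat).
Implicit Types (f g h : hardy R) (s : nat -> R[i]).
Local Notation C := R[i].
Local Notation k := k'.+1.
Local Notation M := (closure [set hardy_of_poly ((polyz R - polyw R) ^+ k * q) |
  q in [set: {poly {poly R[i]}}]]).
Local Notation T := (core_operator M).
Local Notation hA := (multiples_graded R k').
Local Notation core_ratio := (core_ratio R k').

Local Opaque core_operator orth_proj hardy_dot mulz mulw backz backw pgen.

Lemma bounded_coefs_eventually s n0 (B : R) :
  (forall n, (n0 <= n)%N -> Normc.normc (s n) ^+ 2 <= B) -> bounded_coefs s.
Proof.
move=> sB; exists (`|B| + \sum_(i < n0) Normc.normc (s i) ^+ 2) => n.
have S0 : 0 <= \sum_(i < n0) Normc.normc (s i) ^+ 2.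
  by apply: sumr_ge0 => i _; exact: sqr_ge0.
have [n0n|nn0] := leqP n0 n.
  by rewrite (le_trans (sB _ n0n))// (le_trans (ler_norm _))// lerDl.
rewrite (bigD1 (Ordinal nn0))//= addrCA lerDl addr_ge0//.
by apply: sumr_ge0 => i _; exact: sqr_ge0.
Qed.

Lemma normc_core_ratio N : Normc.normc (core_ratio N) = k%:R / N%:R.
Proof.
have normc_nat n : Normc.normc (n%:R : C) = n%:R.
  by rewrite -[n%:R]/((1 : C) *+ n) normcMn Normc.normc1.
by rewrite Normc.normcM Normc.normcV !normc_nat.
Qed.

Lemma core_ratio_small (d : R) : 0 < d ->
  exists n0, forall n, (n0 <= n)%N -> Normc.normc (core_ratio n ^+ 2) <= d.
Proof.
move=> d0; exists (maxn k (Num.bound (k%:R / d))) => n.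
rewrite geq_max => /andP[kn bn].
have n0 : 0 < n%:R :> R by rewrite ltr0n (leq_trans _ kn).
have r1 : k%:R / n%:R <= 1 :> R by rewrite ler_pdivrMr// mul1r ler_nat.
have r0 : 0 <= k%:R / n%:R :> R by rewrite divr_ge0.
rewrite expr2 Normc.normcM !normc_core_ratio.
apply: (@le_trans _ _ (k%:R / n%:R)); first by rewrite ler_piMr.
rewrite ler_pdivrMr// mulrC -ler_pdivrMr//.
have : k%:R / d < (Num.bound (k%:R / d))%:R by apply: archi_boundP; rewrite divr_ge0// ltW.
by move=> /ltW/le_trans; apply; rewrite ler_nat.
Qed.

Variable l : C.
Hypotheses (l_neq0 : l != 0) (l_neq1 : l != 1)
  (l_ratio : forall N, (k < N)%N -> l ^+ 2 != core_ratio N ^+ 2).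

(* In degree N > k the core operator T satisfies T^3 = r^2 T, where r is
   [core_ratio N], so that (T - l)^-1 = -1/l + a T^2 + b T with the
   coefficients below; in degree k, T^2 = T. *)
Definition res_b (N : nat) : C :=
  if (N < k)%N then 0 else if N == k then (l * (1 - l))^-1
  else - (l ^+ 2 - core_ratio N ^+ 2)^-1.

Definition res_a (N : nat) : C := if (N <= k)%N then 0 else l^-1 * res_b N.

(** Because k/N tends to 0, from some degree on |k/N|^2 <= |l|^2 / 2, and the denominators have
    modulus at least |l|^2 / 2. The finitely many earlier degrees are bounded separately. *)
Lemma res_b_bounded : bounded_coefs res_b.
Proof.
pose d := Normc.normc (l ^+ 2).
have d0 : 0 < d.
  rewrite lt_def normc_ge0 andbT; apply/eqP => /Normc.eq0_normc/eqP.
  by rewrite expf_eq0/= (negPf l_neq0).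
have d2 : 0 < d / 2 by rewrite divr_gt0.
have [n0 rn0] := core_ratio_small d2.
apply: (@bounded_coefs_eventually _ (maxn n0 k.+1) (((d / 2)^-1) ^+ 2)) => n.
rewrite geq_max => /andP[n0n kn]; rewrite /res_b ltnNge (ltnW kn)/= gtn_eqF//.
rewrite normcN Normc.normcV lerXn2r ?nnegrE ?invr_ge0 ?normc_ge0 ?(ltW d2)//.
have := le_normcD (l ^+ 2 - core_ratio n ^+ 2) (core_ratio n ^+ 2).
rewrite subrK -/d; have := rn0 _ n0n => h1 h2.
have h3 : d / 2 <= Normc.normc (l ^+ 2 - core_ratio n ^+ 2) by lra.
by rewrite lef_pV2// posrE (lt_le_trans d2).
Qed.

Lemma res_a_bounded : bounded_coefs res_a.
Proof.
have [B bB] := res_b_bounded; apply: (@bounded_coefs_eventually _ k.+1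
  (Normc.normc l^-1 ^+ 2 * B)) => n kn.
by rewrite /res_a leqNgt kn/= Normc.normcM exprMn ler_wpM2l ?sqr_ge0.
Qed.

Definition resolvent f : hardy R :=
  - l^-1 *: f + graded res_a_bounded (T (T f)) + graded res_b_bounded (T f).

Lemma resolvent_is_linear : linear resolvent.
Proof.
have linear3 (F G H : hardy R -> hardy R) : linear F -> linear G -> linear H ->
    linear (fun f => F f + G f + H f).
  move=> Fl Gl Hl c f g; rewrite Fl Gl Hl !scalerDr.
  by rewrite [in RHS]addrACA (addrACA (c *: F f)).
have linear_comp (F G : hardy R -> hardy R) : linear F -> linear G ->
    linear (fun f => F (G f)).
  by move=> Fl Gl c f g; rewrite Gl Fl.
have Tl := core_operator_is_linear hA.
apply: linear3.
- by move=> c f g; rewrite scalerDr !scalerA mulrC.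
- exact: linear_comp (graded_is_linear res_a_bounded) (linear_comp _ _ Tl Tl).
- exact: linear_comp (graded_is_linear res_b_bounded) Tl.
Qed.

HB.instance Definition _ :=
  GRing.isLinear.Build R[i] (hardy R) (hardy R) _ resolvent resolvent_is_linear.

Lemma resolvent_continuous : continuous resolvent.
Proof.
have [Ka HKa] := graded_bounded res_a_bounded.
have [Kb HKb] := graded_bounded res_b_bounded.
have bT f : normsq (T f) <= 22 * normsq f by exact: (core_operator_bounded hA).
pose n := Normc.normc (- l^-1) ^+ 2.
apply: (@bounded_continuous _ resolvent (2 * (2 * (n + `|Ka| * (22 * 22)) + `|Kb| * 22))).
move=> f; rewrite /resolvent/=.
have h1 : normsq (- l^-1 *: f) = n * normsq f by rewrite normsqZ.
have h2 : normsq (graded res_a_bounded (T (T f))) <= `|Ka| * (22 * 22) * normsq f.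
  apply: le_trans (HKa _) _; apply: (@le_trans _ _ (`|Ka| * normsq (T (T f)))).
    by rewrite ler_wpM2r ?normsq_ge0// ler_norm.
  rewrite -!mulrA ler_wpM2l// (le_trans (bT _))// ler_wpM2l//.
have h3 : normsq (graded res_b_bounded (T f)) <= `|Kb| * 22 * normsq f.
  apply: le_trans (HKb _) _; apply: (@le_trans _ _ (`|Kb| * normsq (T f))).
    by rewrite ler_wpM2r ?normsq_ge0// ler_norm.
  by rewrite -!mulrA ler_wpM2l.
have h4 := normsqD_le (- l^-1 *: f) (graded res_a_bounded (T (T f))).
apply: le_trans (normsqD_le _ _) _; rewrite -mulrA ler_wpM2l// mulrDl lerD//.
by rewrite -mulrA (le_trans h4)// ler_wpM2l// mulrDl h1 lerD.
Qed.

Lemma core_resolvent f : T (resolvent f) = resolvent (T f).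
Proof.
rewrite /resolvent [LHS]coreD [X in X + _]coreD [X in X + _ + _]coreZ.
by rewrite [X in _ + X + _]core_graded [X in _ + X]core_graded.
Qed.

(** The resolvent identity at one monomial of degree N: x, t, t2, t3 stand for the coefficients of
    f, T f, T^2 f, T^3 f there. *)
Lemma res_coefsE N (x t t2 t3 : C) :
    ((N < k)%N -> [/\ t = 0, t2 = 0 & t3 = 0]) -> (N = k -> t2 = t) ->
    ((k <= N)%N -> t3 = core_ratio N ^+ 2 * t) ->
  (- l^-1 * t + res_a N * t3 + res_b N * t2) -
    l * (- l^-1 * x + res_a N * t2 + res_b N * t) = x.
Proof.
move=> low idem cube; case: (ltngtP N k) => Nk.
- have [-> -> ->] := low Nk.
  by rewrite !mulr0 !addr0 sub0r mulNr mulrN opprK mulrA divff// mul1r.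
- rewrite (cube (ltnW Nk)) /res_a /res_b leqNgt Nk ltnNge (ltnW Nk)/= gtn_eqF//.
  have := l_ratio Nk; rewrite -subr_eq0 => lr.
  move: (core_ratio N) lr => r lr; field.
  by rewrite l_neq0 lr.
rewrite (idem Nk) /res_a /res_b Nk ltnn leqnn eqxx.
have l1 : 1 - l != 0 by rewrite subr_eq0 eq_sym.
by field; rewrite l_neq0 l1.
Qed.

Lemma resolventE f : resolvent (T f) - l *: resolvent f = f.
Proof.
apply: hardyP => i; set N := (i.1 + i.2)%N.
have E g : resolvent g i = - l^-1 * g i + res_a N * T (T g) i + res_b N * T g i by [].
have E2 (g1 g2 : hardy R) : (g1 - l *: g2) i = g1 i - l * g2 i by [].
rewrite (E2 (resolvent (T f)) (resolvent f)).
apply: etrans (congr2 (fun u v => u - l * v) (E (T f)) (E f)) _.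
apply: res_coefsE => [Nk|Nk|kN].
- by split; [exact: core_low Nk|exact: core_low Nk|exact: core_low Nk].
- exact: core_idem Nk.
- exact: core_cube kN.
Qed.

Lemma resolvent_spectrum : ~ op_spectrum T l.
Proof.
apply; exists resolvent; split; first exact: resolvent_continuous.
  by move=> f; rewrite /= linearB linearZ/= resolventE.
(* The resolvent commutes with T, so the same identity yields the inverse on the other side. *)
by move=> f; rewrite /= core_resolvent resolventE.
Qed.

End Resolvent.

Theorem theorem3p3 (R : realType) (k : nat) (k_ge1 : (1 <= k)%N) :
  let M : set (hardy R) :=
    principal_submodule ((polyz R - polyw R) ^+ k) in
  let C : hardy R -> hardy R := core_operator M in
  let E : set R[i] :=
    [set 0; 1] `|`
    [set x | exists n : nat, (1 <= n)%N /\
       (x = k%:R / (n + k)%:R \/ x = - (k%:R / (n + k)%:R))] in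
  [/\ op_eigenvalues C = E,
      infinite_dimensional (op_eigenspace C 0),
      has_dimension (op_eigenspace C 1) 1
    & op_spectrum C = E].
Proof.
case: k k_ge1 => // k' _ M C E.
have inE0 (l : R[i]) : ~ E l -> l != 0.
  by apply: contra_notN => /eqP ->; left; left.
have inE1 (l : R[i]) : ~ E l -> l != 1.
  by apply: contra_notN => /eqP ->; left; right.
have ratioE l N : (k'.+1 < N)%N -> l ^+ 2 = core_ratio R k' N ^+ 2 -> E l.
  move=> kN /eqP; rewrite eqf_sqr => l2; right; exists (N - k'.+1)%N.
  split; first by rewrite subn_gt0.
  by rewrite subnK 1?ltnW//; case/orP: l2 => /eqP ->; [left|right].
have g0 := gen00_neq0 R k'.
have gC : C (pgen R k'.+1 0 0) = pgen R k'.+1 0 0 by exact: core_gen00.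
have diagC N : C (complete_sym R N) = 0 by exact: core_complete_sym.
have eigE : op_eigenvalues C = E.
  apply/seteqP; split=> [l [x x0 Tx]|l].
    apply: contrapT => El; have l0 := inE0 _ El.
    have [i xi] : exists i, x i != 0.
      apply: contrapT => nx; case/eqP: x0; apply: hardyP => i.
      by apply: contrapT => /eqP xi; apply: nx; exists i.
    (* The degree N of any monomial present in x determines l up to sign: l = 1 if N = k, and l is
       k/N or -k/N if N > k. *)
    have [ki [l2 l1]] := core_eigenvalue l0 Tx xi.
    move: ki; rewrite leq_eqVlt => /orP[/eqP ki|ki]; last exact/El/(ratioE _ _ ki).
    by apply: El; left; right; exact: l1.
  case=> [[->|->]|[n [n1 lm]]].
  - exists (complete_sym R 0); last by rewrite /op_eigenspace/= diagC scale0r.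
    apply/eqP => /(congr1 (fun h : hardy R => h (0, 0)%N)) /eqP.
    by rewrite complete_symE eqxx oner_eq0.
  - by exists (pgen R k'.+1 0 0); rewrite // /op_eigenspace/= gC scale1r.
  case: n n1 lm => // m _ lm.
  have [x x0 Tx] : exists2 x, x != 0 & C x = l *: x.
    case: lm => ->.
      by have := @core_eigenvector R k' 1 m (expr1n _ 2); rewrite mul1r.
    have c2 : (-1 : R[i]) ^+ 2 = 1 by rewrite sqrrN expr1n.
    by have := @core_eigenvector R k' _ m c2; rewrite mulN1r.
  by exists x.
split=> //.
- move=> n; exists (fun i : 'I_n => complete_sym R i); split.
    by move=> c; exact: complete_sym_independent.
  by move=> i; rewrite /op_eigenspace/= diagC scale0r.
- exists (fun=> pgen R k'.+1 0 0); split.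
    move=> c; rewrite big_ord1 => /eqP; rewrite scaler_eq0 (negPf g0) orbF => /eqP c0 i.
    by rewrite (ord1 i).
  apply/seteqP; split=> [x|_ [c _ <-]].
    rewrite /op_eigenspace/= scale1r => /core_eigenspace1[c ->].
    by exists (fun=> c) => //; rewrite big_ord1.
  by rewrite /op_eigenspace/= big_ord1 scale1r /C/= coreZ core_gen00.
(* An eigenvalue is in the spectrum because a left inverse of T - l would send 0 back to the
   eigenvector; the other inclusion is the resolvent construction. *)
rewrite -eigE; apply/seteqP; split=> l; last first.
  move=> [x x0 Tx] [S [_ ST _]]; case/eqP: x0.
  by rewrite -[x]ST /= Tx subrr linear0.
rewrite eigE => Sl; apply: contrapT => El.
apply: (@resolvent_spectrum R k' l) Sl; [exact: inE0|exact: inE1|].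
by move=> N kN; apply/eqP => /(ratioE _ _ kN).
Qed.
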